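(* Let $X$ be a complex vector space with $\dim_{\mathbb{C}}X\ge2$ and let $Y$ be a strictly convex complex normed space which is sequentially complete (Banach). Let $\Omega\subset X$ be a polygonally connected $2$-open set and $f\in\mathcal{H}_G(\Omega,Y)$. If $x\mapsto\|f(x)\|$ has a $\tau_{(1)}$-local maximum on $\Omega$, then $f$ is constant.
   Context: $\Gamma_{1,d}(X)$ is the set of complex affine subspaces of $X$ of dimension between $1$ and $d$, with Euclidean topology. $A\subset X$ is $d$-open if $A\cap L$ is open in $L$ for all $L\in\Gamma_{1,d}(X)$. $\tau_{(1)}$ is the topology on $X$ whose open sets are the $1$-open sets; a $\tau_{(1)}$-local maximum at $c$ means there is a $1$-open set $U\ni c$ with $\|f(x)\|\le\|f(c)\|$ for $x\in U\cap\Omega$. Polygonally connected: any two points joined by a polygonal chain in the set. $\mathcal{H}_G(\Omega,Y)$: maps $f$ such that for all $a\in\Omega$, $v\in X$, $\varphi\in Y^*$, $\lambda\mapsto\varphi(f(a+\lambda v))$ is holomorphic near $0$. *)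

(* Defs.v *)
From HB Require Import structures.
From mathcomp Require Import all_boot all_order all_algebra.
From mathcomp Require Import all_classical all_reals all_analysis.
From mathcomp Require Export complex.
Set Implicit Arguments.
Unset Strict Implicit.
Unset Printing Implicit Defensive.
Import Order.TTheory GRing.Theory Num.Theory.
Import numFieldNormedType.Exports.
Local Open Scope ring_scope.
Local Open Scope classical_set_scope.
Local Open Scope complex_scope.

Section Defs.
Variable R : realType.
Variable X : lmodType R[i].

Definition cindep (k : nat) (v : 'I_k -> X) : Prop :=
  forall t : 'I_k -> R[i], \sum_(j < k) t j *: v j = 0 -> forall j, t j = 0.

Definition dim_ge2 : Prop := exists v : 'I_2 -> X, cindep v.

Definition openCk (k : nat) (P : set ('I_k -> R[i])) : Prop :=
  forall t, P t -> exists e : R, 0 < e /\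
    forall s : 'I_k -> R[i], (forall j, `|s j - t j| < e%:C) -> P s.

(* A is d-open: A /\ L is open in L for every complex affine subspace L of
   dimension between 1 and d; L = a + span_C(v_0..v_{k-1}) with v independent,
   carrying its Euclidean topology through the parametrization C^k -> L. *)
Definition dopen (d : nat) (A : set X) : Prop :=
  forall k : nat, (1 <= k <= d)%N ->
  forall (a : X) (v : 'I_k -> X), cindep v ->
    openCk (fun t : 'I_k -> R[i] => A (a + \sum_(j < k) t j *: v j)).

Definition segment (p q : X) : set X :=
  [set x | exists t : R, 0 <= t <= 1 /\ x = (1 - t%:C) *: p + t%:C *: q].

Fixpoint polychain_in (A : set X) (x : X) (s : seq X) (y : X) : Prop :=
  match s with
  | [::] => segment x y `<=` A
  | z :: s' => segment x z `<=` A /\ polychain_in A z s' y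
  end.

Definition polygonally_connected (A : set X) : Prop :=
  forall x y, A x -> A y -> exists s : seq X, polychain_in A x s y.

Definition has_tau1_local_max (Omega : set X) (n : X -> R[i]) : Prop :=
  exists c : X, Omega c /\
    exists U : set X, dopen 1 U /\ U c /\
      forall x, U x -> Omega x -> n x <= n c.

Variable Y : normedModType R[i].

Definition GateauxHol (Omega : set X) (f : X -> Y) : Prop :=
  forall a : X, Omega a -> forall v : X,
  forall phi : Y -> R[i]^o,
    (forall (c : R[i]) (y1 y2 : Y), phi (c *: y1 + y2) = c * phi y1 + phi y2) ->
    continuous phi ->
    \forall z \near (0 : R[i]^o),
      derivable (fun lam : R[i]^o => phi (f (a + lam *: v))) z 1.

End Defs.

Definition strictly_convex (R : realType) (Y : normedModType R[i]) : Prop :=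
  forall x y : Y, `|x| = 1 -> `|y| = 1 -> x != y ->
    `|(2 : R[i])^-1 *: (x + y)| < 1.

(* Main.v *)
Require Import Defs.
From HB Require Import structures.
From mathcomp Require Import all_boot all_order all_algebra.
From mathcomp Require Import all_classical all_reals all_analysis.
From mathcomp Require Import complex ring lra.
Import Order.TTheory GRing.Theory Num.Theory.
Import numFieldNormedType.Exports.
Local Open Scope ring_scope.
Local Open Scope classical_set_scope.
Local Open Scope complex_scope.
Set Implicit Arguments.
Unset Strict Implicit.
Unset Printing Implicit Defensive.

(** Composing f with a norming functional of f(c) (Hahn-Banach) reduces the maximum
principle on a complex line through c to the scalar one, and strict convexity turns
equality of the norms into equality of the values. So f is constant near c on every
complex line through c. On a 2-plane this gives, by the identity theorem on discs
through c, a full neighbourhood on which f is constant, and this constancy spreads along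
any segment contained in Omega; the neighbourhoods of the end point of the segment
obtained from all 2-planes containing the segment allow the next segment to be treated.

The one-variable theory rests on integrals along the boundary of rectangles: Goursat's
theorem by quartering, then the Cauchy formula on a fixed square. The Cauchy kernel of
the square is only bounded from below, not computed; this loses a constant in the
Cauchy estimate, which is harmless below. *)

Local Notation Re := complex.Re.
Local Notation Im := complex.Im.

(** * Real-valued norms *)

Section RealNorm.
Variable R : realType.

(** Norms over [R[i]] take values in [R[i]], whose order is partial. A norm is real, so its real
    part loses nothing, and estimates on it are within reach of [lra] and [nra]. *)
Definition rnorm (V : normedZmodType R[i]) (x : V) : R := Re `|x|.

Lemma rnormE (V : normedZmodType R[i]) (x : V) : `|x| = (rnorm x)%:C.
Proof. by rewrite /rnorm RRe_real// ger0_real. Qed.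

Lemma rnorm_ge0 (V : normedZmodType R[i]) (x : V) : 0 <= rnorm x.
Proof. by have := normr_ge0 x; rewrite rnormE ler0c. Qed.

Lemma rnorm0 (V : normedZmodType R[i]) : rnorm (0 : V) = 0.
Proof. by apply: complexI; rewrite -rnormE normr0. Qed.

Lemma rnorm0_eq0 (V : normedZmodType R[i]) (x : V) : rnorm x = 0 -> x = 0.
Proof. by move=> x0; apply/eqP; rewrite -normr_eq0 rnormE x0. Qed.

Lemma rnorm_gt0 (V : normedZmodType R[i]) (x : V) : x != 0 -> 0 < rnorm x.
Proof.
move=> x0; rewrite lt_def rnorm_ge0 andbT; apply: contra x0.
by move=> /eqP /rnorm0_eq0 ->.
Qed.

Lemma rnormD (V : normedZmodType R[i]) (x y : V) : rnorm (x + y) <= rnorm x + rnorm y.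
Proof. by rewrite -lecR rmorphD /= -!rnormE ler_normD. Qed.

Lemma rnormN (V : normedZmodType R[i]) (x : V) : rnorm (- x) = rnorm x.
Proof. by rewrite /rnorm normrN. Qed.

Lemma rnormB (V : normedZmodType R[i]) (x y : V) : rnorm (x - y) <= rnorm x + rnorm y.
Proof. by rewrite -(rnormN y) rnormD. Qed.

Lemma rdistC (V : normedZmodType R[i]) (x y : V) : rnorm (x - y) = rnorm (y - x).
Proof. by rewrite /rnorm distrC. Qed.

Lemma rnormM (x y : R[i]) : rnorm (x * y) = rnorm x * rnorm y.
Proof. by apply: complexI; rewrite rmorphM /= -!rnormE normrM. Qed.

Lemma rnormV (x : R[i]) : rnorm x^-1 = (rnorm x)^-1.
Proof. by apply: complexI; rewrite -rnormE normfV rnormE fmorphV. Qed.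

Lemma rnormX (x : R[i]) n : rnorm (x ^+ n) = rnorm x ^+ n.
Proof. by apply: complexI; rewrite -rnormE normrX rnormE rmorphXn. Qed.

Lemma rnorm_real (x : R) : rnorm x%:C = `|x|.
Proof. by rewrite /rnorm normc_def /= expr0n /= addr0 sqrtr_sqr. Qed.

Lemma rnormi : rnorm ('i : R[i]) = 1.
Proof. by rewrite /rnorm normc_def /= expr0n /= add0r expr1n sqrtr1. Qed.

Lemma rnormZ (V : normedModType R[i]) (c : R[i]) (x : V) :
  rnorm (c *: x) = rnorm c * rnorm x.
Proof. by apply: complexI; rewrite rmorphM /= -!rnormE normrZ. Qed.

Lemma rnorm_sqr (z : R[i]) : rnorm z ^+ 2 = Re z ^+ 2 + Im z ^+ 2.
Proof. by apply: complexI; rewrite rmorphXn /= -rnormE add_Re2_Im2. Qed.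

Lemma Re_le_rnorm (z : R[i]) : `|Re z| <= rnorm z.
Proof. by rewrite -lecR -rnormE normc_ge_Re. Qed.

Lemma Im_le_rnorm (z : R[i]) : `|Im z| <= rnorm z.
Proof.
by rewrite -(@ler_pXn2r _ 2%N) ?nnegrE ?rnorm_ge0// rnorm_sqr real_normK ?num_real// lerDr sqr_ge0.
Qed.

Lemma rnorm_le_ReIm (z : R[i]) : rnorm z <= `|Re z| + `|Im z|.
Proof.
rewrite -(@ler_pXn2r _ 2%N) ?nnegrE ?rnorm_ge0 ?addr_ge0// rnorm_sqr.
rewrite sqrrD !real_normK ?num_real//; have := normr_ge0 (Re z).
by have := normr_ge0 (Im z) => *; rewrite -addrA lerD2l lerDr mulrn_wge0 ?mulr_ge0.
Qed.

End RealNorm.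

(** * Induction on rectangles by quartering *)

Section Cousin.
Variable R : realType.

(* Rectangles are given by their lower left corner and their two sides.
   Without the conclusion, repeated quartering produces nested rectangles that
   all violate P and shrink to a point. *)
Lemma rectangle_cousin (P : R -> R -> R -> R -> Prop) (x0 y0 a b : R) :
  0 <= a -> 0 <= b ->
  (forall x y a b, 0 <= a -> 0 <= b ->
     P x y a b -> P (x + a) y a b -> P x (y + b) a b -> P (x + a) (y + b) a b ->
     P x y (a + a) (b + b)) ->
  (forall X Y, x0 <= X <= x0 + a -> y0 <= Y <= y0 + b ->
     exists2 d : R, 0 < d & forall x y a' b', 0 <= a' < d -> 0 <= b' < d ->
      x0 <= x -> x + a' <= x0 + a -> y0 <= y -> y + b' <= y0 + b ->
      x <= X <= x + a' -> y <= Y <= y + b' -> P x y a' b') ->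
  P x0 y0 a b.
Proof.
move=> a0 b0 Pq Ploc; apply: contrapT => nP.
pose sa n : R := a / 2 ^+ n; pose sb n : R := b / 2 ^+ n.
have saE n : sa n = sa n.+1 + sa n.+1.
  by rewrite /sa exprS; field; rewrite expf_neq0.
have sbE n : sb n = sb n.+1 + sb n.+1.
  by rewrite /sb exprS; field; rewrite expf_neq0.
have sa0 n : 0 <= sa n by rewrite divr_ge0 ?exprn_ge0.
have sb0 n : 0 <= sb n by rewrite divr_ge0 ?exprn_ge0.
pose bad n (c : R * R) := ~ P c.1 c.2 (sa n) (sb n).
(* The implication stands under the existential so that [nxt] is defined at every corner, bad or
   not. *)
have step n (c : R * R) : exists c' : R * R, bad n c ->
   [/\ bad n.+1 c', c'.1 = c.1 \/ c'.1 = c.1 + sa n.+1 &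
       c'.2 = c.2 \/ c'.2 = c.2 + sb n.+1].
  have [bc|] := pselect (bad n c); last by exists c.
  have [p1|p1] := pselect (bad n.+1 c).
    by exists c => _; split=> //; left.
  have [p2|p2] := pselect (bad n.+1 (c.1 + sa n.+1, c.2)).
    by eexists=> _; split; [exact: p2|right|left].
  have [p3|p3] := pselect (bad n.+1 (c.1, c.2 + sb n.+1)).
    by eexists=> _; split; [exact: p3|left|right].
  have [p4|p4] := pselect (bad n.+1 (c.1 + sa n.+1, c.2 + sb n.+1)).
    by eexists=> _; split; [exact: p4|right|right].
  exfalso; apply: bc; rewrite saE sbE.
  by apply: Pq; rewrite ?sa0 ?sb0//; apply: contrapT.
pose nxt n c := projT1 (cid (step n c)).
pose fix cs n := if n is m.+1 then nxt m (cs m) else (x0, y0).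
have csbad n : bad n (cs n).
  elim: n => [|n IH]; first by rewrite /bad /sa /sb !expr0 !divr1.
  by have [] := projT2 (cid (step n (cs n))) IH.
have cs1 n : (cs n.+1).1 = (cs n).1 \/ (cs n.+1).1 = (cs n).1 + sa n.+1.
  by have [] := projT2 (cid (step n (cs n))) (csbad n).
have cs2 n : (cs n.+1).2 = (cs n).2 \/ (cs n.+1).2 = (cs n).2 + sb n.+1.
  by have [] := projT2 (cid (step n (cs n))) (csbad n).
(* Nested intervals, one coordinate at a time: each left end is below each right end, so the
   supremum of the left ends lies in all the intervals. *)
have lim (u s : nat -> R) : (forall n, 0 <= s n) -> (forall n, s n = s n.+1 + s n.+1) ->
    (forall n, u n.+1 = u n \/ u n.+1 = u n + s n.+1) ->
    exists X, forall n, [/\ u n <= X <= u n + s n, u 0%N <= u n & u n + s n <= u 0%N + s 0%N].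
  move=> s0 sE uS.
  have mono k n : u n <= u (n + k)%N /\ u (n + k)%N + s (n + k)%N <= u n + s n.
    elim: k => [|k [IH1 IH2]]; first by rewrite addn0.
    have := sE (n + k)%N; have := s0 (n + k).+1; rewrite addnS.
    by case: (uS (n + k)%N) => ->; lra.
  have ub m n : u m <= u n + s n.
    have [mn|nm] := leqP m n.
      have [] := mono (n - m)%N m; rewrite subnKC//; have := s0 n; lra.
    by have [] := mono (m - n)%N n; rewrite subnKC 1?ltnW//; have := s0 m; lra.
  exists (sup (range u)) => n; split.
  - apply/andP; split.
      by apply: ub_le_sup; [exists (u 0%N + s 0%N) => _ [m _ <-]|exists n].
    by apply: ge_sup; [exists (u 0%N); exists 0%N|move=> _ [m _ <-]].
  - by have [] := mono n 0%N; rewrite add0n.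
  - by have [] := mono n 0%N; rewrite add0n.
have [X HX] := lim _ _ sa0 saE cs1; have [Y HY] := lim _ _ sb0 sbE cs2.
have [/= X0 _ _] := HX 0%N; have [/= Y0 _ _] := HY 0%N.
move: X0 Y0; rewrite /sa /sb expr0 !divr1 => X0 Y0.
have [d d0 Pd] := Ploc X Y X0 Y0.
have [n [nsa nsb]] : exists n, sa n < d /\ sb n < d.
  have pow2 n : n%:R < 2 ^+ n :> R by rewrite -natrX ltr_nat ltn_expl.
  have [n Hn] : exists n, (a + b) / d < n%:R.
    by exists (Num.bound ((a + b) / d)); apply: archi_boundP; rewrite divr_ge0 ?addr_ge0// ltW.
  have := lt_trans Hn (pow2 n); rewrite ltr_pdivrMr// => H.
  have p0 : 0 < 2 ^+ n :> R by rewrite exprn_gt0.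
  by exists n; rewrite /sa /sb !ltr_pdivrMr// !(mulrC d); split; lra.
apply: (csbad n); have [HX1 HX2 HX3] := HX n; have [HY1 HY2 HY3] := HY n.
move: HX2 HX3 HY2 HY3; rewrite /= /sa /sb !expr0 !divr1 => *.
by apply: Pd; rewrite ?sa0 ?sb0 ?nsa ?nsb.
Qed.

End Cousin.

(** * Integrals of complex-valued functions *)

Section ComplexIntegral.
Variable R : realType.
Local Notation C := R[i].
Local Notation mu := (@lebesgue_measure R).

Lemma Re_add (x y : C) : Re (x + y) = Re x + Re y.
Proof. by case: x y => [? ?] []. Qed.
Lemma Im_add (x y : C) : Im (x + y) = Im x + Im y.
Proof. by case: x y => [? ?] []. Qed.
Lemma Re_opp (x : C) : Re (- x) = - Re x.
Proof. by case: x. Qed.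
Lemma Im_opp (x : C) : Im (- x) = - Im x.
Proof. by case: x. Qed.
Lemma Re_mul (x y : C) : Re (x * y) = Re x * Re y - Im x * Im y.
Proof. by case: x y => [? ?] []. Qed.
Lemma Im_mul (x y : C) : Im (x * y) = Re x * Im y + Im x * Re y.
Proof. by case: x y => [? ?] [? ?]. Qed.
Definition ReImE := (Re_add, Im_add, Re_opp, Im_opp, Re_mul, Im_mul).

Lemma eqReIm (x y : C) : Re x = Re y -> Im x = Im y -> x = y.
Proof. by case: x y => [? ?] [? ?] /= -> ->. Qed.

(** The point [s] is not confined to [[a, b]]: this is continuity of [g] on the whole line at each
    point of the segment. *)
Definition pathcont (g : R -> C) (a b : R) : Prop :=
  forall t, a <= t <= b -> forall e : R, 0 < e ->
  exists2 d : R, 0 < d & forall s, `|s - t| < d -> rnorm (g s - g t) < e.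

Lemma pathcont_cst (k : C) a b : pathcont (fun=> k) a b.
Proof. by move=> t _ e e0; exists 1 => // s _; rewrite subrr rnorm0. Qed.

Lemma pathcontD g h a b : pathcont g a b -> pathcont h a b ->
  pathcont (fun t => g t + h t) a b.
Proof.
move=> gc hc t tab e e0; have e20 : 0 < e / 2 by rewrite divr_gt0.
have [d d0 gd] := gc t tab _ e20; have [d' d'0 hd] := hc t tab _ e20.
exists (Num.min d d') => [|s]; first by rewrite lt_min d0.
rewrite lt_min => /andP[/gd g1 /hd h1].
rewrite (_ : _ - _ = (g s - g t) + (h s - h t)); last by ring.
have := rnormD (g s - g t) (h s - h t); lra.
Qed.

Lemma pathcontZ k g a b : pathcont g a b -> pathcont (fun t => k * g t) a b.
Proof.
move=> gc t tab e e0; have k1 : 0 < rnorm k + 1 by have := rnorm_ge0 k; lra.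
have [d d0 gd] := gc t tab _ (divr_gt0 e0 k1).
exists d => // s /gd; rewrite -mulrBr rnormM ltr_pdivlMr//.
by have := rnorm_ge0 (g s - g t); nra.
Qed.

Lemma pathcontB g h a b : pathcont g a b -> pathcont h a b ->
  pathcont (fun t => g t - h t) a b.
Proof.
move=> gc hc; have := pathcontD gc (pathcontZ (-1) hc).
by under [X in pathcont X]eq_fun do rewrite mulN1r.
Qed.

Let real_cont_integrable (u : R -> R) a b :
  (forall t, a <= t <= b -> forall e : R, 0 < e ->
   exists2 d : R, 0 < d & forall s, `|s - t| < d -> `|u s - u t| < e) ->
  mu.-integrable `[a, b] (EFin \o u).
Proof.
move=> uc; apply: continuous_compact_integrable; first exact: segment_compact.
apply: continuous_in_subspaceT => t /set_mem /=; rewrite in_itv /= => tab.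
apply/cvgrPdist_lt => e e0; have [d d0 ud] := uc t tab e e0.
apply/nbhs_normP; exists d => //= s; rewrite /= distrC => /ud.
by rewrite distrC.
Qed.

Lemma pathcont_Re g a b : pathcont g a b ->
  mu.-integrable `[a, b] (EFin \o (fun t => Re (g t))).
Proof.
move=> gc; apply: real_cont_integrable => t tab e e0.
have [d d0 gd] := gc t tab e e0; exists d => // s /gd; apply: le_lt_trans.
by rewrite -Re_opp -Re_add Re_le_rnorm.
Qed.

Lemma pathcont_Im g a b : pathcont g a b ->
  mu.-integrable `[a, b] (EFin \o (fun t => Im (g t))).
Proof.
move=> gc; apply: real_cont_integrable => t tab e e0.
have [d d0 gd] := gc t tab e e0; exists d => // s /gd; apply: le_lt_trans.
by rewrite -Im_opp -Im_add Im_le_rnorm.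
Qed.

Definition cint (g : R -> C) (a b : R) : C :=
  (\int[mu]_(t in `[a, b]) Re (g t)) +i* (\int[mu]_(t in `[a, b]) Im (g t)).

Lemma eq_cint g h a b : (forall t, a <= t <= b -> g t = h t) ->
  cint g a b = cint h a b.
Proof.
move=> gh; rewrite /cint; congr (_ +i* _); apply: eq_Rintegral => t /set_mem /=;
  by rewrite in_itv /= => /gh ->.
Qed.

Lemma cintD g h a b : pathcont g a b -> pathcont h a b ->
  cint (fun t => g t + h t) a b = cint g a b + cint h a b.
Proof.
move=> gc hc; apply: eqReIm; rewrite ?Re_add ?Im_add /=.
- rewrite -RintegralD//=; try exact: pathcont_Re.
  by apply: eq_Rintegral => t _; rewrite Re_add.
- rewrite -RintegralD//=; try exact: pathcont_Im.
  by apply: eq_Rintegral => t _; rewrite Im_add.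
Qed.

Let real_cont_Zl (u : R -> R) k a b : mu.-integrable `[a, b] (EFin \o u) ->
  mu.-integrable `[a, b] (EFin \o (fun t => k * u t)).
Proof. by move=> iu; apply: (@integrableZl _ _ _ mu _ _ k _ iu). Qed.

Lemma cintZ k g a b : pathcont g a b ->
  cint (fun t => k * g t) a b = k * cint g a b.
Proof.
move=> gc; have iR := pathcont_Re gc; have iI := pathcont_Im gc.
apply: eqReIm; rewrite ?Re_mul ?Im_mul /=.
- rewrite -!RintegralZl// -RintegralB//; try exact: real_cont_Zl.
  by apply: eq_Rintegral => t _; rewrite Re_mul.
- rewrite -!RintegralZl// -RintegralD//; try exact: real_cont_Zl.
  by apply: eq_Rintegral => t _; rewrite Im_mul.
Qed.

Lemma cintB g h a b : pathcont g a b -> pathcont h a b ->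
  cint (fun t => g t - h t) a b = cint g a b - cint h a b.
Proof.
move=> gc hc; rewrite -mulN1r -cintZ// -cintD//; last exact: pathcontZ.
by apply: eq_cint => t _; rewrite mulN1r.
Qed.

Let fine_itv a b : a <= b -> fine (mu `[a, b]) = b - a.
Proof.
move=> ab; rewrite lebesgue_measure_itv /= lte_fin.
by case: ltgtP ab => // -> _; rewrite subrr.
Qed.

Lemma cint_cst k a b : a <= b -> cint (fun=> k) a b = k * (b - a)%:C.
Proof.
move=> ab; apply: eqReIm; rewrite ?Re_mul ?Im_mul /= Rintegral_cst//= fine_itv//;
  by rewrite mulr0 ?subr0 ?add0r.
Qed.

Let real_int_bound (u : R -> R) a b M : a <= b -> 
  mu.-integrable `[a, b] (EFin \o u) -> (forall t, a <= t <= b -> `|u t| <= M) ->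
  `|\int[mu]_(t in `[a, b]) u t| <= M * (b - a).
Proof.
move=> ab iu uM; apply: le_trans (le_normr_Rintegral _ iu) _ => //.
rewrite -(fine_itv ab) -Rintegral_cst//; apply: le_Rintegral => //.
- exact: (integrable_abse iu).
- exact: (pathcont_Re (@pathcont_cst M%:C a b)).
Qed.

(** The factor 2 comes from estimating the real and the imaginary part separately. *)
Lemma cint_bound g a b M : a <= b -> pathcont g a b ->
  (forall t, a <= t <= b -> rnorm (g t) <= M) ->
  rnorm (cint g a b) <= 2 * M * (b - a).
Proof.
move=> ab gc gM; apply: le_trans (rnorm_le_ReIm _) _ => /=.
have gR t : a <= t <= b -> `|Re (g t)| <= M.
  by move=> /gM; apply: le_trans; exact: Re_le_rnorm.
have gI t : a <= t <= b -> `|Im (g t)| <= M.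
  by move=> /gM; apply: le_trans; exact: Im_le_rnorm.
have := real_int_bound ab (pathcont_Re gc) gR.
have := real_int_bound ab (pathcont_Im gc) gI; lra.
Qed.

Lemma Re_cint_ge g a b m : a <= b -> pathcont g a b ->
  (forall t, a <= t <= b -> m <= Re (g t)) -> m * (b - a) <= Re (cint g a b).
Proof.
move=> ab gc gm; rewrite /= -(fine_itv ab) -Rintegral_cst//.
apply: le_Rintegral => //.
- exact: (pathcont_Re (@pathcont_cst m%:C a b)).
- exact: pathcont_Re.
Qed.

Lemma Im_cint_ge g a b m : a <= b -> pathcont g a b ->
  (forall t, a <= t <= b -> m <= Im (g t)) -> m * (b - a) <= Im (cint g a b).
Proof.
move=> ab gc gm; rewrite /= -(fine_itv ab) -Rintegral_cst//.
apply: le_Rintegral => //.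
- exact: (pathcont_Re (@pathcont_cst m%:C a b)).
- exact: pathcont_Im.
Qed.

Let real_int_split (u : R -> R) a b c : a <= b -> b <= c ->
  mu.-integrable `[a, c] (EFin \o u) ->
  \int[mu]_(t in `[a, c]) u t =
  \int[mu]_(t in `[a, b]) u t + \int[mu]_(t in `[b, c]) u t.
Proof.
(* Subtracting the integral up to [b] leaves a half-open interval; the missing end point does not
   change the integral. *)
move=> ab bc iu; rewrite -[X in _ + X]Rintegral_itv_obnd_cbnd; last first.
  by apply: integrableS iu => //= t /=; rewrite !in_itv /=; lra.
by rewrite -(Rintegral_itvB iu) ?bnd_simp// addrC subrK.
Qed.

Lemma cint_split g a b c : a <= b -> b <= c -> pathcont g a c ->
  cint g a c = cint g a b + cint g b c.
Proof.
move=> ab bc gc; apply: eqReIm; rewrite ?Re_add ?Im_add; apply: real_int_split => //.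
- exact: pathcont_Re.
- exact: pathcont_Im.
Qed.

End ComplexIntegral.

(** * Boundary integrals of rectangles *)

Section Rectangle.
Variable R : realType.
Local Notation C := R[i].

(** The scalars being [R[i]], derivability along the vector 1 is complex differentiability. *)
Definition holo (h : C -> C) (z : C) : Prop :=
  derivable (h : C^o -> C^o) z 1.

Definition ccont (h : C -> C) (z : C) : Prop :=
  forall e : R, 0 < e -> exists2 d : R, 0 < d &
    forall w, rnorm (w - z) < d -> rnorm (h w - h z) < e.

Lemma holo_expand h z : holo h z -> exists l : C, forall e : R, 0 < e ->
  exists2 d : R, 0 < d & forall w, rnorm (w - z) < d ->
    rnorm (h w - h z - l * (w - z)) <= e * rnorm (w - z).
Proof.
move=> /cvg_ex[l hl]; exists l => e e0.
have eC : 0 < e%:C :> C by rewrite ltcR.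
have H := (cvgrPdist_le _ _).1 hl _ eC.
have [d /= d0 dP] := (@nbhs_ballP _ C^o 0 (fun t : C => t != 0 ->
  `|l - t^-1 *: ((h \o shift z) (t *: 1) - h z)| <= e%:C)).1 (H _).
have dE : (Re d)%:C = d by rewrite RRe_real// gtr0_real.
exists (Re d) => [|w]; first by rewrite -ltcR dE.
have [->|wz wd] := eqVneq w z; first by rewrite !subrr mulr0 subr0 rnorm0 mulr0.
have wz0 : w - z != 0 by rewrite subr_eq0.
have /= := dP (w - z); rewrite -ball_normE /= sub0r normrN rnormE -dE ltcR.
move=> /(_ wd wz0); rewrite rnormE lecR.
have -> : l - (w - z)^-1 *: (h ((w - z) *: 1 + z) - h z) =
   - ((w - z)^-1 * (h w - h z - l * (w - z))).
  rewrite [_ *: 1]mulr1 subrK [_ *: _]/(_ * _).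
  by rewrite [in RHS]mulrBr (mulrC l) mulrA mulVf// mul1r opprB.
rewrite rnormN rnormM rnormV mulrC ler_pdivrMr//; exact: rnorm_gt0.
Qed.

Lemma holo_ccont h z : holo h z -> ccont h z.
Proof.
move=> /holo_expand[l hl] e e0.
have [d d0 dP] := hl 1 ltr01.
have l1 : 0 < rnorm l + 1 by have := rnorm_ge0 l; lra.
exists (Num.min d (e / (rnorm l + 1))) => [|w].
  by rewrite lt_min d0 divr_gt0.
rewrite lt_min ltr_pdivlMr// => /andP[wd we].
have := dP w wd; rewrite mul1r => H.
have := rnormD (h w - h z - l * (w - z)) (l * (w - z)); rewrite subrK rnormM.
by move: (rnorm _) (rnorm _) (rnorm _) (rnorm _) H we => *; lra.
Qed.

Lemma pathcont_h h y a b : (forall t, a <= t <= b -> ccont h (t +i* y)) ->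
  pathcont (fun t => h (t +i* y)) a b.
Proof.
move=> hc t tab e e0; have [d d0 dP] := hc t tab e e0; exists d => // s sd.
apply: dP; rewrite (_ : _ - _ = (s - t)%:C) ?rnorm_real//.
by apply: eqReIm => //=; rewrite subrr.
Qed.

Lemma pathcont_v h x a b : (forall t, a <= t <= b -> ccont h (x +i* t)) ->
  pathcont (fun t => h (x +i* t)) a b.
Proof.
move=> hc t tab e e0; have [d d0 dP] := hc t tab e e0; exists d => // s sd.
apply: dP; rewrite (_ : _ - _ = 'i * (s - t)%:C) ?rnormM ?rnormi ?mul1r ?rnorm_real//.
by apply: eqReIm => /=; rewrite ?subrr; ring.
Qed.

(** The integral of [h] along the boundary, counterclockwise, with opposite sides combined: bottom
    minus top, then right minus left with the factor ['i] of a vertical side. *)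
Definition rint (h : C -> C) (x y a b : R) : C :=
  cint (fun t => h (t +i* y) - h (t +i* (y + b))) x (x + a) +
  'i * cint (fun t => h ((x + a) +i* t) - h (x +i* t)) y (y + b).

Definition edgecont h (x y a b : R) : Prop :=
  (forall t, x <= t <= x + a -> ccont h (t +i* y) /\ ccont h (t +i* (y + b))) /\
  (forall t, y <= t <= y + b -> ccont h (x +i* t) /\ ccont h ((x + a) +i* t)).

Lemma edgecont_cint h x y a b : edgecont h x y a b ->
  [/\ pathcont (fun t => h (t +i* y)) x (x + a),
      pathcont (fun t => h (t +i* (y + b))) x (x + a),
      pathcont (fun t => h (x +i* t)) y (y + b) &
      pathcont (fun t => h ((x + a) +i* t)) y (y + b)].
Proof.
move=> [H1 H2]; split.
- by apply: pathcont_h => t /H1[].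
- by apply: pathcont_h => t /H1[].
- by apply: pathcont_v => t /H2[].
- by apply: pathcont_v => t /H2[].
Qed.

(** The common vertical side is run through in both directions and cancels; the horizontal sides are
    concatenated. *)
Lemma rint_splitx h x y a a' b : 0 <= a -> 0 <= a' ->
  edgecont h x y a b -> edgecont h (x + a) y a' b ->
  rint h x y (a + a') b = rint h x y a b + rint h (x + a) y a' b.
Proof.
move=> a0 a'0 E1 E2.
have [A1 A2 A3 A4] := edgecont_cint E1; have [B1 B2 B3 B4] := edgecont_cint E2.
rewrite /rint !addrA.
have E : edgecont h x y (a + a') b.
  split=> t; rewrite ?addrA => tb.
    have [ta|ta] := leP t (x + a); first by apply: E1.1; lra.
    by apply: E2.1; lra.
  by split; [apply: (E1.2 _ tb).1|apply: (E2.2 _ tb).2].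
have [C1 C2 C3 C4] := edgecont_cint E.
rewrite addrA in C1 C2 C4.
rewrite (@cint_split _ _ x (x + a) (x + a + a')) ?lerDl//; last exact: pathcontB.
rewrite (cintB A1 A2) (cintB A4 A3) (cintB B1 B2) (cintB B4 B3) (cintB C4 C3).
by ring.
Qed.

Lemma rint_splity h x y a b b' : 0 <= b -> 0 <= b' ->
  edgecont h x y a b -> edgecont h x (y + b) a b' ->
  rint h x y a (b + b') = rint h x y a b + rint h x (y + b) a b'.
Proof.
move=> b0 b'0 E1 E2.
have [A1 A2 A3 A4] := edgecont_cint E1; have [B1 B2 B3 B4] := edgecont_cint E2.
rewrite /rint !addrA.
have E : edgecont h x y a (b + b').
  split=> t; rewrite ?addrA => tb.
    by split; [apply: (E1.1 _ tb).1|apply: (E2.1 _ tb).2].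
  have [ta|ta] := leP t (y + b); first by apply: E1.2; lra.
  by apply: E2.2; lra.
have [C1 C2 C3 C4] := edgecont_cint E.
rewrite addrA in C2 C3 C4.
rewrite (@cint_split _ _ y (y + b) (y + b + b')) ?lerDl//; last exact: pathcontB.
rewrite (cintB A1 A2) (cintB A4 A3) (cintB B1 B2) (cintB B4 B3) (cintB C1 C2).
by ring.
Qed.

Definition inrect (x y a b : R) (z : C) : Prop :=
  x <= Re z <= x + a /\ y <= Im z <= y + b.

Definition onedge (x y a b : R) (z : C) : Prop :=
  inrect x y a b z /\ [\/ Re z = x, Re z = x + a, Im z = y | Im z = y + b].

Lemma edgecontP h x y a b : 0 <= a -> 0 <= b ->
  (forall z, onedge x y a b z -> ccont h z) -> edgecont h x y a b.
Proof.
move=> a0 b0 hc; split=> t tab; split; apply: hc; split.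
- by split=> /=; lra.
- exact: Or43.
- by split=> /=; lra.
- exact: Or44.
- by split=> /=; lra.
- exact: Or41.
- by split=> /=; lra.
- exact: Or42.
Qed.

(** This is [M] times the perimeter, up to the factor 2 lost in [cint_bound]. *)
Lemma rint_bound h x y a b M : 0 <= a -> 0 <= b -> edgecont h x y a b ->
  (forall z, onedge x y a b z -> rnorm (h z) <= M) ->
  rnorm (rint h x y a b) <= 4 * M * (a + b).
Proof.
move=> a0 b0 /edgecont_cint[A1 A2 A3 A4] hM.
apply: le_trans (rnormD _ _) _; rewrite rnormM rnormi mul1r.
have B1 : rnorm (cint (fun t => h (t +i* y) - h (t +i* (y + b))) x (x + a)) <= 
    2 * (M + M) * (x + a - x).
  apply: cint_bound; rewrite ?lerDl//; first exact: pathcontB.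
  move=> t tx; apply: le_trans (rnormB _ _) _; apply: lerD; apply: hM; split;
    try by split=> /=; lra.
    exact: Or43.
  exact: Or44.
have B2 : rnorm (cint (fun t => h ((x + a) +i* t) - h (x +i* t)) y (y + b)) <= 
    2 * (M + M) * (y + b - y).
  apply: cint_bound; rewrite ?lerDl//; first exact: pathcontB.
  move=> t tx; apply: le_trans (rnormB _ _) _; apply: lerD; apply: hM; split;
    try by split=> /=; lra.
    exact: Or42.
  exact: Or41.
lra.
Qed.

(** An affine function differs by a constant between opposite sides, so both integrands are constant
    and the two contributions cancel. *)
Lemma rint_affine (k l : C) x y a b : 0 <= a -> 0 <= b ->
  rint (fun z => k + l * z) x y a b = 0.
Proof.
move=> a0 b0; rewrite /rint.
rewrite (@eq_cint _ _ (fun=> - l * 'i * b%:C)); last first.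
  by move=> t _; apply: eqReIm; rewrite !ReImE /=; ring.
rewrite (@eq_cint _ (fun t => k + l * (_ +i* t) - _) (fun=> l * a%:C)); last first.
  by move=> t _; apply: eqReIm; rewrite !ReImE /=; ring.
rewrite !cint_cst ?lerDl// (addrC x) (addrC y) !addrK; ring.
Qed.

Lemma rintD h g x y a b : edgecont h x y a b -> edgecont g x y a b ->
  rint (fun z => h z + g z) x y a b = rint h x y a b + rint g x y a b.
Proof.
move=> /edgecont_cint[A1 A2 A3 A4] /edgecont_cint[B1 B2 B3 B4].
rewrite /rint (cintB A1 A2) (cintB A4 A3) (cintB B1 B2) (cintB B4 B3).
rewrite (cintB (pathcontD A1 B1) (pathcontD A2 B2)).
rewrite (cintB (pathcontD A4 B4) (pathcontD A3 B3)).
rewrite (cintD A1 B1) (cintD A2 B2) (cintD A3 B3) (cintD A4 B4); ring.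
Qed.

Lemma rintZ k h x y a b : edgecont h x y a b ->
  rint (fun z => k * h z) x y a b = k * rint h x y a b.
Proof.
move=> /edgecont_cint[A1 A2 A3 A4]; rewrite /rint.
rewrite (cintB A1 A2) (cintB A4 A3).
rewrite (cintB (pathcontZ k A1) (pathcontZ k A2)).
rewrite (cintB (pathcontZ k A4) (pathcontZ k A3)).
rewrite (cintZ k A1) (cintZ k A2) (cintZ k A3) (cintZ k A4); ring.
Qed.

Lemma eq_rint h g x y a b : 0 <= a -> 0 <= b ->
  (forall z, onedge x y a b z -> h z = g z) ->
  rint h x y a b = rint g x y a b.
Proof.
move=> a0 b0 hg; rewrite /rint; congr (_ + _ * _); apply: eq_cint => t tb.
  by rewrite !hg//; split; try (by split=> /=; lra); [exact: Or44|exact: Or43].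
by rewrite !hg//; split; try (by split=> /=; lra); [exact: Or41|exact: Or42].
Qed.

End Rectangle.

(** * Goursat's theorem *)

Section Cauchy.
Variable R : realType.
Local Notation C := R[i].
Implicit Types (h k : C -> C) (z p : C).

Lemma eq0_of_small (v : R) (K : R) : 0 <= v ->
  (forall e : R, 0 < e -> v <= e * K) -> v = 0.
Proof.
move=> v0 vK; apply/eqP; rewrite eq_le v0 andbT leNgt; apply/negP => vp.
have K1 : 0 < `|K| + 1 by have := normr_ge0 K; lra.
have e0 : 0 < v / (2 * (`|K| + 1)) by rewrite divr_gt0//; lra.
have := vK _ e0; have : v / (2 * (`|K| + 1)) * (2 * (`|K| + 1)) = v.
  by rewrite divfK//; lra.
by have := ler_norm K; move: (v / _) e0 => e; nra.
Qed.

(** The bound [e * (4 * (a + b) ^+ 2)] grows by the factor 4 when the sides double, so a rectangle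
    inherits it from its quarters. On a small rectangle around a point, the affine part of [h]
    integrates to 0 and the remainder is at most [e * (a + b)] on the boundary. *)
Lemma goursat h (x y a b : R) : 0 <= a -> 0 <= b ->
  (forall z, inrect x y a b z -> holo h z) -> rint h x y a b = 0.
Proof.
move=> a0 b0 hh; apply: rnorm0_eq0.
apply: (@eq0_of_small _ (4 * (a + b) ^+ 2)) => [|e e0]; first exact: rnorm_ge0.
(* The trivial premises become, for subrectangles, the inclusion in the initial rectangle, where [h]
   is holomorphic. *)
suff : x <= x -> x + a <= x + a -> y <= y -> y + b <= y + b ->
    rnorm (rint h x y a b) <= e * (4 * (a + b) ^+ 2) by exact.
apply: (@rectangle_cousin _ (fun x' y' a' b' => x <= x' -> x' + a' <= x + a ->
  y <= y' -> y' + b' <= y + b ->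
    rnorm (rint h x' y' a' b') <= e * (4 * (a' + b') ^+ 2))) => //.
  move=> x' y' a' b' a'0 b'0.
  have F (u c w v : R) : 0 <= c -> u <= w -> w + (c + c) <= v ->
    [/\ u <= w + c, w + c <= v & w + c + c <= v] by move=> *; split; lra.
  have ec x1 y1 a1 b1 : 0 <= a1 -> 0 <= b1 -> x <= x1 -> x1 + a1 <= x + a ->
     y <= y1 -> y1 + b1 <= y + b -> edgecont h x1 y1 a1 b1.
    move=> *; apply: edgecontP => // z [[? ?] _].
    by apply: holo_ccont; apply: hh; split; lra.
  move=> H1 H2 H3 H4 xx xa yy yb.
  have [x1 x2 x3] := F _ _ _ _ a'0 xx xa.
  have [y1 y2 y3] := F _ _ _ _ b'0 yy yb.
  have bb0 := addr_ge0 b'0 b'0.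
  rewrite rint_splitx ?rint_splity//; try exact: ec.
  have {H1} n1 := H1 xx x2 yy y2; have {H2} n2 := H2 x1 x3 yy y2.
  have {H3} n3 := H3 xx x2 y1 y3; have {H4} n4 := H4 x1 x3 y1 y3.
  set r1 := rint _ _ _ _ _ in n1 *; set r2 := rint _ (x' + a') y' _ _ in n2 *.
  set r3 := rint _ x' _ _ _ in n3 *; set r4 := rint _ _ _ _ _ in n4 *.
  have := rnormD (r1 + r3) (r2 + r4); have := rnormD r1 r3.
  have := rnormD r2 r4.
  have -> : e * (4 * (a' + a' + (b' + b')) ^+ 2) = 4 * (e * (4 * (a' + b') ^+ 2)).
    by ring.
  move: (rnorm _) (rnorm _) (rnorm _) (rnorm _) (rnorm _) (rnorm _) (rnorm _) n1 n2 n3 n4.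
  by clear; move: (e * _) => *; lra.
move=> X Y xX yY; have [l hl] := holo_expand (hh (X +i* Y) (conj xX yY)).
have [d d0 dP] := hl e e0; exists (d / 2) => [|x' y' a' b']; first lra.
move=> /andP[a'0 a'd] /andP[b'0 b'd] xx xa yy yb xX' yY' _ _ _ _.
have ec : edgecont h x' y' a' b'.
  apply: edgecontP => // z [[? ?] _].
  by apply: holo_ccont; apply: hh; split; lra.
pose q : C := X +i* Y.
pose g z := (h q - l * q) + l * z.
have gec : edgecont g x' y' a' b'.
  apply: edgecontP => // z _; apply: holo_ccont; apply: derivableD.
    exact: derivable_cst.
  by apply: derivableM; [exact: derivable_cst|exact: derivable_id].
pose r z := h z + (-1) * g z.
have rec : edgecont r x' y' a' b'.
  apply: edgecontP => // z [[? ?] _]; apply: holo_ccont; apply: derivableD.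
    by apply: hh; split; lra.
  apply: derivableM; first exact: derivable_cst.
  apply: derivableD; first exact: derivable_cst.
  by apply: derivableM; [exact: derivable_cst|exact: derivable_id].
have -> : rint h x' y' a' b' = rint r x' y' a' b'.
  rewrite (@eq_rint _ h (fun z => r z + g z))//; last by move=> z _; rewrite /r; ring.
  by rewrite rintD// rint_affine// addr0.
apply: le_trans (rint_bound a'0 b'0 rec (M := e * (a' + b')) _) _; last by nra.
move=> z [[zx zy] _].
have zq : rnorm (z - q) <= a' + b'.
  apply: le_trans (rnorm_le_ReIm _) _; rewrite !ReImE /=.
  by apply: lerD; rewrite ler_norml; lra.
have -> : r z = h z - h q - l * (z - q) by rewrite /r /g; ring.
apply: le_trans (dP z _) _; first by apply: le_lt_trans zq _; lra.
by rewrite ler_pM2l.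
Qed.

(** Cut off the left and right strips, then the pieces below and above the inner rectangle. On each
    of these four closed rectangles [k] is holomorphic and Goursat's theorem gives 0. *)
Lemma rint_middle k (x y a1 a2 a3 b1 b2 b3 : R) :
  0 <= a1 -> 0 <= a2 -> 0 <= a3 -> 0 <= b1 -> 0 <= b2 -> 0 <= b3 ->
  (forall z, inrect x y (a1 + (a2 + a3)) (b1 + (b2 + b3)) z ->
    ~ (x + a1 < Re z < x + a1 + a2 /\ y + b1 < Im z < y + b1 + b2) -> holo k z) ->
  rint k x y (a1 + (a2 + a3)) (b1 + (b2 + b3)) = rint k (x + a1) (y + b1) a2 b2.
Proof.
move=> a10 a20 a30 b10 b20 b30 hk.
have ec x1 y1 a b : 0 <= a -> 0 <= b -> x <= x1 -> x1 + a <= x + (a1 + (a2 + a3)) ->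
     y <= y1 -> y1 + b <= y + (b1 + (b2 + b3)) ->
     (x1 <= x + a1 \/ x + a1 + a2 <= x1) ->
     (x1 + a <= x + a1 \/ x + a1 + a2 <= x1 + a) ->
     (y1 <= y + b1 \/ y + b1 + b2 <= y1) ->
     (y1 + b <= y + b1 \/ y + b1 + b2 <= y1 + b) -> edgecont k x1 y1 a b.
  move=> ? ? ? ? ? ? X1 X2 Y1 Y2; apply: edgecontP => // z [[? ?] zE].
  apply: holo_ccont; apply: hk; first by clear X1 X2 Y1 Y2 zE; split; lra.
  move=> [? ?]; case: zE => zE.
  - by clear X2 Y1 Y2; case: X1; lra.
  - by clear X1 Y1 Y2; case: X2; lra.
  - by clear X1 X2 Y2; case: Y1; lra.
  - by clear X1 X2 Y1; case: Y2; lra.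
have g0 x1 y1 a b : 0 <= a -> 0 <= b -> x <= x1 -> x1 + a <= x + (a1 + (a2 + a3)) ->
     y <= y1 -> y1 + b <= y + (b1 + (b2 + b3)) ->
     [\/ x1 + a <= x + a1, x + a1 + a2 <= x1, y1 + b <= y + b1 | y + b1 + b2 <= y1] ->
     rint k x1 y1 a b = 0.
  move=> ? ? ? ? ? ? X; apply: goursat => // z [? ?]; apply: hk.
    by clear X; split; lra.
  by move=> [? ?]; case: X; lra.
have rl : rint k x y a1 (b1 + (b2 + b3)) = 0.
  by apply: g0; try (by apply: Or41; lra); lra.
have rr : rint k (x + a1 + a2) y a3 (b1 + (b2 + b3)) = 0.
  by apply: g0; try (by apply: Or42; lra); lra.
have rb : rint k (x + a1) y a2 b1 = 0.
  by apply: g0; try (by apply: Or43; lra); lra.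
have rt : rint k (x + a1) (y + b1 + b2) a2 b3 = 0.
  by apply: g0; try (by apply: Or44; lra); lra.
rewrite rint_splitx ?addr_ge0//; try by apply: ec; lra.
rewrite rl rint_splitx ?addr_ge0//; try by apply: ec; lra.
rewrite rr rint_splity ?addr_ge0//; try by apply: ec; lra.
rewrite rb rint_splity ?addr_ge0//; try by apply: ec; lra.
by rewrite rt !add0r !addr0.
Qed.

End Cauchy.

(** * The Cauchy formula on a square *)

Section CauchyFormula.
Variable R : realType.
Local Notation C := R[i].
Implicit Types (h k : C -> C) (z p : C).

(** The square has centre 0 and half side 2, so that points with both coordinates at most 1 in
    absolute value keep distance at least 1 from its boundary. *)
Definition inQ z : Prop := inrect (-2) (-2) 4 4 z.
Definition onQ z : Prop := onedge (-2) (-2) 4 4 z.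
Definition rintQ h : C := rint h (-2) (-2) 4 4.

Lemma holo_cst (c : C) z : holo (fun=> c) z.
Proof. exact: derivable_cst. Qed.

Lemma holo_id z : holo id z.
Proof. exact: derivable_id. Qed.

Lemma holoD h k z : holo h z -> holo k z -> holo (fun w => h w + k w) z.
Proof. exact: derivableD. Qed.

Lemma holoB h k z : holo h z -> holo k z -> holo (fun w => h w - k w) z.
Proof. exact: derivableB. Qed.

Lemma holoM h k z : holo h z -> holo k z -> holo (fun w => h w * k w) z.
Proof. exact: derivableM. Qed.

Lemma holoV h z : h z != 0 -> holo h z -> holo (fun w => (h w)^-1) z.
Proof. exact: derivableV. Qed.

Lemma holoX h n z : holo h z -> holo (fun w => h w ^+ n) z.
Proof.
move=> hh; elim: n => [|n IH]; first exact: holo_cst.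
by under [X in holo X]eq_fun do rewrite exprS; exact: holoM.
Qed.

Lemma edgecontQ h : (forall z, onQ z -> holo h z) -> edgecont h (-2) (-2) 4 4.
Proof. by move=> hh; apply: edgecontP => // z /hh /holo_ccont. Qed.

Lemma onQ_dist z p (c : R) : onQ z -> `|Re p| <= c -> `|Im p| <= c ->
  2 - c <= rnorm (z - p).
Proof.
move=> [_ zE]; rewrite !ler_norml => /andP[r1 r2] /andP[i1 i2].
have := Re_le_rnorm (z - p); have := Im_le_rnorm (z - p).
rewrite !ReImE !ler_norml => /andP[I1 I2] /andP[R1 R2].
by move: (rnorm _) I1 I2 R1 R2 => n I1 I2 R1 R2; case: zE => zE; lra.
Qed.

Lemma inQ_center p : `|Re p| <= 1 -> `|Im p| <= 1 -> inQ p.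
Proof. by rewrite !ler_norml => ? ?; split; lra. Qed.

(** The difference quotient is holomorphic off [p] and bounded near [p]. The integral can thus be
    moved to a square of half side [e] about [p], where it is at most a constant times [e]. *)
Lemma cauchy_diff h p : (forall z, inQ z -> holo h z) ->
  `|Re p| <= 1 -> `|Im p| <= 1 ->
  rintQ (fun z => (h z - h p) * (z - p)^-1) = 0.
Proof.
move=> hh p1 p2; set k := fun z => _.
have [l hl] := holo_expand (hh _ (inQ_center p1 p2)).
have [d d0 dP] := hl 1 ltr01.
have hk z : inQ z -> z != p -> holo k z.
  move=> zQ zp; apply: holoM.
    by apply: holoB; [exact: hh|exact: holo_cst].
  apply: holoV; first by rewrite subr_eq0.
  by apply: holoB; [exact: holo_id|exact: holo_cst].
have kb z : z != p -> rnorm (z - p) < d -> rnorm (k z) <= rnorm l + 1.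
  move=> zp zd; have zp0 : 0 < rnorm (z - p) by apply: rnorm_gt0; rewrite subr_eq0.
  rewrite /k rnormM rnormV ler_pdivrMr//.
  have := rnormD (h z - h p - l * (z - p)) (l * (z - p)).
  by have := dP z zd; rewrite subrK rnormM; lra.
apply: rnorm0_eq0.
apply: (@eq0_of_small _ _ (16 * (rnorm l + 1))) => [|e' e'0]; first exact: rnorm_ge0.
(* The bound [2^-1] keeps the small square inside the large one, and [d / 4] keeps it within
   distance [d] of [p]. *)
pose e : R := Num.min e' (Num.min 2^-1 (d / 4)).
have e0 : 0 < e by rewrite !lt_min e'0 invr_gt0 ltr0n divr_gt0.
have ee : e <= e' by rewrite /e ge_min lexx.
have e2 : e <= 2^-1 by rewrite /e !ge_min lexx orbT.
have ed : e <= d / 4 by rewrite /e !ge_min lexx !orbT.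
move: p1 p2; rewrite !ler_norml => /andP[r1 r2] /andP[i1 i2].
have small z : inrect (Re p - e) (Im p - e) (2 * e) (2 * e) z -> rnorm (z - p) < d.
  move=> [/andP[z1 z2] /andP[z3 z4]]; apply: le_lt_trans (rnorm_le_ReIm _) _.
  rewrite !ReImE; apply: (@le_lt_trans _ _ (e + e)); last by lra.
  by apply: lerD; rewrite ler_norml; lra.
have edgeN z : onedge (Re p - e) (Im p - e) (2 * e) (2 * e) z -> z != p.
  by move=> [_ zE]; apply/eqP => zp; case: zE; rewrite zp; lra.
have sub z : inrect (Re p - e) (Im p - e) (2 * e) (2 * e) z -> inQ z.
  by move=> [? ?]; split; lra.
have -> : rintQ k = rint k (Re p - e) (Im p - e) (2 * e) (2 * e).
  have := @rint_middle _ k (-2) (-2) (Re p - e + 2) (2 * e) (2 - Re p - e)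
    (Im p - e + 2) (2 * e) (2 - Im p - e).
  have -> : Re p - e + 2 + (2 * e + (2 - Re p - e)) = 4 by lra.
  have -> : Im p - e + 2 + (2 * e + (2 - Im p - e)) = 4 by lra.
  have -> : -2 + (Re p - e + 2) = Re p - e by lra.
  have -> : -2 + (Im p - e + 2) = Im p - e by lra.
  apply; try lra.
  move=> z zQ zn; apply: hk => //; apply/eqP => zp; apply: zn.
  by rewrite zp; split; lra.
have e20 : 0 <= 2 * e by lra.
apply: le_trans (rint_bound e20 e20 (M := rnorm l + 1) _ _) _.
- apply: edgecontP => // z zE; apply: holo_ccont; apply: hk; last exact: edgeN.
  by apply: sub; case: zE.
- by move=> z zE; apply: kb; [exact: edgeN|apply: small; case: zE].
- by have := rnorm_ge0 l; nra.
Qed.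

Definition windQ p : C := rintQ (fun z => (z - p)^-1).

Lemma holo_invB p z : z != p -> holo (fun w => (w - p)^-1) z.
Proof.
move=> zp; apply: holoV; first by rewrite subr_eq0.
by apply: holoB; [exact: holo_id|exact: holo_cst].
Qed.

Lemma onQ_neq z p : onQ z -> `|Re p| <= 1 -> `|Im p| <= 1 -> z != p.
Proof.
move=> zQ p1 p2; apply/eqP => zp.
by have := onQ_dist zQ p1 p2; rewrite zp subrr rnorm0; lra.
Qed.

Lemma cauchy_square h p : (forall z, inQ z -> holo h z) ->
  `|Re p| <= 1 -> `|Im p| <= 1 ->
  rintQ (fun z => h z * (z - p)^-1) = h p * windQ p.
Proof.
move=> hh p1 p2.
have ne z : onQ z -> z != p by move=> zQ; exact: onQ_neq.
have c1 : edgecont (fun z => (z - p)^-1) (-2) (-2) 4 4.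
  by apply: edgecontQ => z /ne; exact: holo_invB.
have c2 : edgecont (fun z => h p * (z - p)^-1) (-2) (-2) 4 4.
  by apply: edgecontQ => z /ne zp; apply: holoM; [exact: holo_cst|exact: holo_invB].
have c3 : edgecont (fun z => (h z - h p) * (z - p)^-1) (-2) (-2) 4 4.
  apply: edgecontQ => z zQ; apply: holoM; last exact/holo_invB/ne.
  by apply: holoB; [apply: hh; case: zQ|exact: holo_cst].
rewrite /windQ {2}/rintQ -rintZ// -[RHS]add0r -(cauchy_diff hh p1 p2) /rintQ.
by rewrite -rintD//; apply: eq_rint => // z _; rewrite mulrBl subrK.
Qed.

Lemma Im_inv z : Im z^-1 = - (Im z / (Re z ^+ 2 + Im z ^+ 2)).
Proof. by case: z. Qed.

Lemma Re_inv z : Re z^-1 = Re z / (Re z ^+ 2 + Im z ^+ 2).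
Proof. by case: z. Qed.

(** Only the imaginary part is estimated. The four sides all contribute non-negatively to it; the
    integrands on the two horizontal sides are at least [18^-1] each, over a length of 4. *)
Lemma windQ_ge p : `|Re p| <= 1 -> `|Im p| <= 1 -> 4 / 9 <= rnorm (windQ p).
Proof.
move=> p1 p2; apply: le_trans (Im_le_rnorm _); apply: le_trans (ler_norm _).
have c1 : edgecont (fun z => (z - p)^-1) (-2) (-2) 4 4.
  by apply: edgecontQ => z zQ; apply: holo_invB; exact: onQ_neq.
have [A1 A2 A3 A4] := edgecont_cint c1.
move: p1 p2; rewrite !ler_norml => /andP[r1 r2] /andP[i1 i2].
rewrite /windQ /rintQ /rint Im_add Im_mul [Re 'i]/= [Im 'i]/= mul0r add0r mul1r.
have frac (s d : R) : 0 <= d -> -3 <= s <= 3 -> 1 <= d <= 3 -> 18^-1 <= d / (s ^+ 2 + d ^+ 2).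
  move=> d0 /andP[s1 s2] /andP[d1 d2].
  have s9 : s ^+ 2 <= 9 by rewrite expr2; nra.
  have d9 : d ^+ 2 <= 9 by rewrite expr2; nra.
  have p0 : 0 < s ^+ 2 + d ^+ 2 by have := sqr_ge0 s; have : 0 < d * d; [nra|rewrite -expr2; lra].
  by rewrite ler_pdivlMr//; lra.
have I1 : 9^-1 * (-2 + 4 - -2) <= Im (cint (fun t =>
    (t +i* -2 - p)^-1 - (t +i* (-2 + 4) - p)^-1) (-2) (-2 + 4)).
  apply: Im_cint_ge; first lra; first exact: pathcontB.
  move=> t tb; rewrite Im_add Im_opp !Im_inv !ReImE /=.
  have := frac (t - Re p) (2 + Im p) _ _ _.
  have := frac (t - Re p) (2 - Im p) _ _ _.
  have -> : -2 - Im p = - (2 + Im p) by ring.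
  have -> : -2 + 4 - Im p = 2 - Im p by ring.
  rewrite sqrrN mulNr !opprK.
  by move=> F1 F2; have {}F1 := F1 ltac:(lra) ltac:(lra) ltac:(lra);
    have {}F2 := F2 ltac:(lra) ltac:(lra) ltac:(lra); lra.
have I2 : 0 * (-2 + 4 - -2) <= Re (cint (fun t =>
    ((-2 + 4) +i* t - p)^-1 - (-2 +i* t - p)^-1) (-2) (-2 + 4)).
  apply: Re_cint_ge; first lra; first exact: pathcontB.
  move=> t tb; rewrite Re_add Re_opp !Re_inv !ReImE /=.
  have -> : -2 - Re p = - (2 + Re p) by ring.
  have n0 (c d : R) : 0 <= c ^+ 2 + d ^+ 2 by rewrite addr_ge0 ?sqr_ge0.
  by rewrite sqrrN mulNr opprK; apply: addr_ge0; apply: divr_ge0 => //; lra.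
have E9 : (9^-1 : R) * 9 = 1 by rewrite mulVf.
by move: I1 I2; rewrite /=; lra.
Qed.

Lemma rintQ_bound h M : (forall z, onQ z -> holo h z) ->
  (forall z, onQ z -> rnorm (h z) <= M) -> rnorm (rintQ h) <= 32 * M.
Proof.
move=> hh hM; apply: le_trans (rint_bound _ _ (edgecontQ hh) hM) _ => //.
lra.
Qed.

(** On the boundary the kernel is at most 1 in modulus, and [72 = 32 / (4 / 9)]. *)
Lemma cauchy_estimate h p M : (forall z, inQ z -> holo h z) ->
  `|Re p| <= 1 -> `|Im p| <= 1 -> (forall z, onQ z -> rnorm (h z) <= M) ->
  rnorm (h p) <= 72 * M.
Proof.
move=> hh p1 p2 hM.
have H : rnorm (h p * windQ p) <= 32 * M.
  rewrite -cauchy_square//; apply: rintQ_bound => z zQ.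
    apply: holoM; first by apply: hh; case: zQ.
    by apply: holo_invB; exact: onQ_neq.
  rewrite rnormM rnormV ler_pdivrMr; last first.
    by apply: lt_le_trans (onQ_dist zQ p1 p2); lra.
  have := onQ_dist zQ p1 p2; have := hM z zQ; have := rnorm_ge0 (h z); nra.
rewrite rnormM in H; have := windQ_ge p1 p2; have := rnorm_ge0 (h p); nra.
Qed.

End CauchyFormula.

(** * Identity theorem and maximum modulus *)

Section MaximumModulus.
Variable R : realType.
Local Notation C := R[i].
Implicit Types (h k : C -> C) (z p : C).

(** Here [rectangle_cousin] replaces compactness: bounds on four quarters give one on the rectangle,
    and continuity gives one near each point. *)
Lemma bounded_on_Q h : (forall z, inQ z -> ccont h z) ->
  exists M, forall z, inQ z -> rnorm (h z) <= M.
Proof.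
move=> hc.
suff [M hM] : exists M, forall z, inQ z -> inrect (-2) (-2) 4 4 z -> rnorm (h z) <= M.
  by exists M => z zQ; exact: hM.
apply: (@rectangle_cousin _ (fun x y a b =>
  exists M, forall z, inQ z -> inrect x y a b z -> rnorm (h z) <= M)) => //.
  move=> x y a b a0 b0 [M1 H1] [M2 H2] [M3 H3] [M4 H4].
  exists (Num.max (Num.max M1 M2) (Num.max M3 M4)) => z zQ [/andP[z1 z2] /andP[z3 z4]].
  rewrite !le_max.
  have [xa|xa] := leP (Re z) (x + a); have [yb|yb] := leP (Im z) (y + b).
  - by rewrite H1//; split; apply/andP.
  - by rewrite H3 ?orbT//; split; apply/andP; split=> //; lra.
  - by rewrite H2 ?orbT//; split; apply/andP; split=> //; lra.
  - by rewrite H4 ?orbT//; split; apply/andP; split=> //; lra.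
move=> X Y xX yY; have [d d0 dP] := hc (X +i* Y) (conj xX yY) 1 ltr01.
exists (d / 2) => [|x y a b]; first by rewrite divr_gt0.
move=> /andP[a0 ad] /andP[b0 bd] _ _ _ _ /andP[X1 X2] /andP[Y1 Y2].
exists (rnorm (h (X +i* Y)) + 1) => z _ [/andP[z1 z2] /andP[z3 z4]].
have zd : rnorm (z - X +i* Y) < d.
  apply: le_lt_trans (rnorm_le_ReIm _) _; rewrite !ReImE /=.
  apply: (@le_lt_trans _ _ (a + b)); last by lra.
  by apply: lerD; rewrite ler_norml; lra.
have := rnormD (h z - h (X +i* Y)) (h (X +i* Y)); rewrite subrK.
by have := dP z zd; lra.
Qed.

Lemma holo_near h k z (d : R) : 0 < d -> (forall w, rnorm (w - z) < d -> h w = k w) ->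
  holo h z -> holo k z.
Proof.
move=> d0 hk; apply: near_eq_derivable.
apply/(@nbhs_ballP _ C^o); exists d%:C => /=; first by rewrite ltcR.
by move=> w; rewrite -ball_normE /= rnormE ltcR rdistC => /hk.
Qed.

(* Dividing by z^n costs nothing at 0 and gains a factor 2^-n on the boundary. *)
Lemma holo_identity h (d : R) p : 0 < d -> (forall z, inQ z -> holo h z) ->
  (forall z, rnorm z < d -> h z = 0) -> rnorm p <= 1 -> h p = 0.
Proof.
move=> d0 hh h0 p1.
have [M hM] : exists M, forall z, inQ z -> rnorm (h z) <= M.
  by apply: bounded_on_Q => z /hh /holo_ccont.
have [->|pn0] := eqVneq p 0; first by rewrite h0// rnorm0.
have pp : 0 < rnorm p by exact: rnorm_gt0.
have M0 : 0 <= M.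
  by apply: le_trans (hM 0 _); [exact: rnorm_ge0|split=> /=; lra].
have key n : rnorm (h p) <= 72 * (M / 2 ^+ n).
  have : rnorm (h p * (p ^+ n)^-1) <= 72 * (M / 2 ^+ n).
    apply: (@cauchy_estimate _ (fun z => h z * (z ^+ n)^-1)).
    (* At 0 the quotient is differentiable because it is identically 0 on the disc where [h]
       vanishes. *)
    - move=> z zQ; have [->|zn0] := eqVneq z 0.
        apply: (@holo_near (fun=> 0) _ _ d) => // [w|]; last exact: holo_cst.
        by rewrite subr0 => /h0 ->; rewrite mul0r.
      apply: holoM; first exact: hh.
      apply: holoV; first by rewrite expf_neq0.
      by apply: holoX; exact: holo_id.
    - exact: le_trans (Re_le_rnorm _) p1.
    - exact: le_trans (Im_le_rnorm _) p1.
    - move=> z zQ; have z2 : 2 <= rnorm z.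
        have := @onQ_dist _ z 0 0 zQ; rewrite !subr0; apply; by rewrite /= normr0.
      rewrite rnormM rnormV rnormX; apply: ler_pM; rewrite ?rnorm_ge0//.
      + by rewrite invr_ge0 exprn_ge0// rnorm_ge0.
      + by apply: hM; case: zQ.
      + by rewrite lef_pV2 ?posrE ?exprn_gt0//; [rewrite lerXn2r ?nnegrE//; lra|lra].
  apply: le_trans; rewrite rnormM rnormV rnormX ler_pdivlMr ?exprn_gt0//.
  by rewrite ler_piMr ?rnorm_ge0// exprn_ile1// ltW.
apply: rnorm0_eq0; apply: (@eq0_of_small _ _ (72 * M)); first exact: rnorm_ge0.
move=> e e0; pose n := Num.bound e^-1.
have en : e^-1 < 2 ^+ n.
  apply: lt_trans (archi_boundP _) _; first by rewrite invr_ge0 ltW.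
  by rewrite -natrX ltr_nat ltn_expl.
apply: le_trans (key n) _; rewrite (_ : e * _ = 72 * (M * e)); last by ring.
rewrite ler_wpM2l// ler_wpM2l//.
have t0 : 0 < (2 ^+ n : R) by rewrite exprn_gt0.
by rewrite -(invrK e) lef_pV2 ?posrE ?invr_gt0// ltW.
Qed.

(** The Cauchy formula at 0 has value 0, so it can be subtracted from the one at [p]. The kernel
    becomes [p / ((z - p) * z)], of modulus at most [rnorm p / 2] on the boundary, and
    [36 = 32 / 2 / (4 / 9)]. *)
Lemma schwarz_estimate k p : (forall z, inQ z -> holo k z) -> k 0 = 0 ->
  (forall z, inQ z -> rnorm (k z) <= 1) -> rnorm p <= 1 ->
  rnorm (k p) <= 36 * rnorm p.
Proof.
move=> hk k0 k1 p1.
have r1 := le_trans (Re_le_rnorm _) p1; have i1 := le_trans (Im_le_rnorm _) p1.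
have o1 : `|Re (0 : C)| <= 0 by rewrite /= normr0.
have o2 : `|Im (0 : C)| <= 0 by rewrite /= normr0.
have o3 : `|Re (0 : C)| <= 1 by rewrite /= normr0.
have o4 : `|Im (0 : C)| <= 1 by rewrite /= normr0.
pose g (q : C) z := k z * (z - q)^-1.
have hg q : `|Re q| <= 1 -> `|Im q| <= 1 -> forall z, onQ z -> holo (g q) z.
  move=> q1 q2 z zQ; apply: holoM; first by apply: hk; case: zQ.
  by apply: holo_invB; exact: onQ_neq.
have hg0 z : onQ z -> holo (fun z => (-1) * g 0 z) z.
  by move=> zQ; apply: holoM; [exact: holo_cst|exact: hg].
have E : k p * windQ p = rintQ (fun z => g p z + (-1) * g 0 z).
  rewrite /rintQ rintD; [|exact/edgecontQ/hg|exact/edgecontQ/hg0].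
  rewrite rintZ; last exact/edgecontQ/hg.
  rewrite -!/(rintQ _) /g (cauchy_square hk r1 i1) (cauchy_square hk o3 o4).
  by rewrite k0 mul0r mulr0 addr0.
have : rnorm (k p * windQ p) <= 32 * (rnorm p / 2).
  rewrite E; apply: rintQ_bound => z zQ.
    by apply: holoD; [exact: hg|exact: hg0].
  have zp := onQ_neq zQ r1 i1; have z0 := onQ_neq zQ o3 o4.
  have -> : g p z + (-1) * g 0 z = k z * (p * ((z - p)^-1 * z^-1)).
    by rewrite /g subr0; field; rewrite z0 subr_eq0 zp.
  have kz : rnorm (k z) <= 1 by apply: k1; case: zQ.
  have d1 := onQ_dist zQ r1 i1; have := onQ_dist zQ o1 o2; rewrite !subr0 => d2.
  have {}d1 : 1 <= rnorm (z - p) by apply: le_trans d1; lra.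
  rewrite !rnormM !rnormV.
  have D1 : (rnorm (z - p))^-1 <= 1 by rewrite invf_le1//; lra.
  have D2 : (rnorm z)^-1 <= 2^-1 by rewrite lef_pV2 ?posrE//; lra.
  rewrite -[leRHS]mul1r; apply: ler_pM; rewrite ?mulr_ge0 ?invr_ge0 ?rnorm_ge0//.
  apply: ler_wpM2l; first exact: rnorm_ge0.
  by rewrite -[leRHS]mul1r; apply: ler_pM; rewrite ?invr_ge0 ?rnorm_ge0.
rewrite rnormM; have := windQ_ge r1 i1; have := rnorm_ge0 (k p).
by have := rnorm_ge0 p; nra.
Qed.

(* With [u = A - h], the quotients [u / (u + s)], s > 0, are bounded by 1 and vanish at 0;
   as s tends to 0, the Schwarz estimate gives |u p| <= |u p| / 2. *)
Lemma strong_maximum h (A : R) p : (forall z, inQ z -> holo h z) -> 0 < A ->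
  h 0 = A%:C -> (forall z, inQ z -> rnorm (h z) <= A) -> rnorm p <= 72^-1 ->
  h p = A%:C.
Proof.
move=> hh A0 h0 hA p72.
pose u z := A%:C - h z.
have hu z : inQ z -> holo u z.
  by move=> zQ; apply: holoB; [exact: holo_cst|exact: hh].
have uR z : inQ z -> 0 <= Re (u z).
  move=> /hA; have := Re_le_rnorm (h z); rewrite ler_norml /u !ReImE /=.
  by move=> /andP[_ ?] ?; lra.
have pQ : inQ p.
  have := Re_le_rnorm p; have := Im_le_rnorm p; rewrite !ler_norml.
  by move=> /andP[? ?] /andP[? ?]; split; lra.
suff : u p = 0 by move=> /eqP; rewrite subr_eq0 => /eqP <-.
apply: rnorm0_eq0; apply: (@eq0_of_small _ _ 1) => [|s s0]; first exact: rnorm_ge0.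
(* Adding [s > 0] to a number with non-negative real part does not decrease its modulus and makes it
   nonzero. *)
have us z : inQ z -> rnorm (u z) <= rnorm (u z + s%:C) /\ 0 < rnorm (u z + s%:C).
  move=> zQ; have u0 := uR z zQ.
  have rE : Re (u z + s%:C) = Re (u z) + s by rewrite Re_add.
  have iE : Im (u z + s%:C) = Im (u z) by rewrite Im_add addr0.
  have R0 : 0 < rnorm (u z + s%:C).
    by apply: lt_le_trans (Re_le_rnorm _); rewrite rE gtr0_norm; lra.
  split=> //; rewrite -(@ler_pXn2r _ 2%N) ?nnegrE ?rnorm_ge0//.
  by rewrite !rnorm_sqr rE iE; nra.
have := @schwarz_estimate (fun z => u z * (u z + s%:C)^-1) p.
have us0 := us p pQ; rewrite rnormM rnormV.
move=> /(_ _ _ _ _) H.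
have {H} : rnorm (u p) / rnorm (u p + s%:C) <= 36 * rnorm p.
  apply: H.
  - move=> z zQ; apply: holoM; first exact: hu.
    apply: holoV; last by apply: holoD; [exact: hu|exact: holo_cst].
    by have [_] := us z zQ; apply: contraTneq => ->; rewrite rnorm0 ltxx.
  - by rewrite /u h0 subrr mul0r.
  - move=> z /us[z1 z2]; rewrite rnormM rnormV ler_pdivrMr//; lra.
  - lra.
rewrite ler_pdivrMr; last by case: us0.
(* Since [36 * rnorm p <= 1 / 2], the modulus of [u p] is at most half of itself plus [s / 2], hence
   at most [s]. *)
have := rnormD (u p) s%:C; rewrite rnorm_real gtr0_norm//.
have := rnorm_ge0 (u p); have := rnorm_ge0 p; nra.
Qed.

End MaximumModulus.

(** * Vector-valued functions *)

Section HahnBanach.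
Variables (R : realType) (Y : normedModType R[i]).
Local Notation C := R[i].

(** Graphs of real-linear functionals on real subspaces, dominated by the norm; single-valuedness
    follows from domination. The last clause is conditional so that the empty set, the union of the
    empty chain, qualifies in Zorn's lemma. *)
Definition dominated_graph (y0 : Y) (G : set (Y * R)) : Prop :=
  [/\ forall x r, G (x, r) -> r <= rnorm x,
      forall (c : R) x r x' r', G (x, r) -> G (x', r') ->
        G (c%:C *: x + x', c * r + r') &
      forall e, G e -> G (y0, rnorm y0)].

(** The value [al] at [z] must lie between all [r - rnorm (x - z)] and all [rnorm (x + z) - r]. By
    the triangle inequality each of the former is at most each of the latter, so the supremum of the
    former serves. *)
Lemma dominated_graph_ext (y0 z : Y) (G : set (Y * R)) : dominated_graph y0 G ->
  G (y0, rnorm y0) -> exists2 G', dominated_graph y0 G' &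
    G `<=` G' /\ exists r, G' (z, r).
Proof.
move=> [Gdom Glin _] Gy0.
have G0 : G (0, 0).
  have := Glin (-1) _ _ _ _ Gy0 Gy0.
  by rewrite rmorphN1 scaleN1r addNr mulN1r addNr.
have GZ (c : R) x r : G (x, r) -> G (c%:C *: x, c * r).
  by move=> Gx; have := Glin c _ _ _ _ Gx G0; rewrite !addr0.
have GD x r x' r' : G (x, r) -> G (x', r') -> G (x + x', r + r').
  by move=> Gx Gx'; have := Glin 1 _ _ _ _ Gx Gx'; rewrite rmorph1 scale1r mul1r.
pose L := [set s | exists x r, G (x, r) /\ s = r - rnorm (x - z)].
have Lub x r : G (x, r) -> ubound L (rnorm (x + z) - r).
  move=> Gx _ [x' [r' [Gx' ->]]].
  have := Gdom _ _ (GD _ _ _ _ Gx Gx'); have := rnormD (x + z) (x' - z).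
  by rewrite addrACA subrr addr0; lra.
have L0 : L !=set0 by exists (0 - rnorm (0 - z)), 0, 0.
pose al := sup L.
have al_le x r : G (x, r) -> al <= rnorm (x + z) - r.
  by move=> Gx; apply: ge_sup => //; exact: Lub.
have al_ge x r : G (x, r) -> r - rnorm (x - z) <= al.
  move=> Gx; apply: ub_le_sup; last by exists x, r.
  by exists (rnorm (0 + z) - 0); exact: Lub.
pose G' := [set e | exists x r (t : R), G (x, r) /\ e = (x + t%:C *: z, r + t * al)].
exists G'; last first.
  split; last by exists (0 + 1 * al), 0, 0, 1; rewrite rmorph1 scale1r !add0r.
  by move=> [x r] Gx; exists x, r, 0; rewrite scale0r mul0r !addr0.
split.
- move=> _ _ [x [r [t [Gx [-> ->]]]]].
  (* Dividing by the absolute value of [t] reduces domination to [x + z] or [x - z], that is, to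
     [al_le] or [al_ge]. *)
  have [t0|t0|->] := ltgtP t 0; last first.
  + by rewrite scale0r mul0r !addr0; exact: Gdom.
  + have := al_le _ _ (GZ t^-1 _ _ Gx).
    have -> : x + t%:C *: z = t%:C *: ((t^-1)%:C *: x + z).
      rewrite scalerDr scalerA -rmorphM /= mulfV ?rmorph1 ?scale1r//.
      by rewrite gt_eqF.
    rewrite rnormZ rnorm_real gtr0_norm//.
    rewrite lerBrDr -(ler_pM2l t0) mulrDr mulrA mulfV ?gt_eqF// mul1r; lra.
  + have s0 : 0 < - t by lra.
    have := al_ge _ _ (GZ (- t)^-1 _ _ Gx).
    have -> : x + t%:C *: z = (- t)%:C *: (((- t)^-1)%:C *: x - z).
      rewrite scalerBr scalerA -rmorphM /= mulfV ?rmorph1 ?scale1r ?gt_eqF//.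
      by rewrite rmorphN scaleNr opprK.
    rewrite rnormZ rnorm_real gtr0_norm//.
    rewrite lerBlDr -(ler_pM2l s0) mulrDr mulrA mulfV ?gt_eqF// mul1r; lra.
- move=> c _ _ _ _ [x [r [t [Gx [-> ->]]]]] [x' [r' [t' [Gx' [-> ->]]]]].
  exists (c%:C *: x + x'), (c * r + r'), (c * t + t'); split; first exact: Glin.
  congr pair; last by ring.
  by rewrite scalerDr scalerA rmorphD rmorphM scalerDl /= addrACA.
- by move=> _ _; exists y0, (rnorm y0), 0; rewrite scale0r mul0r !addr0.
Qed.

Lemma real_norming_functional (y0 : Y) : exists u : Y -> R,
  [/\ forall (c : R) x x', u (c%:C *: x + x') = c * u x + u x',
      forall x, u x <= rnorm x & u y0 = rnorm y0].
Proof.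
have [|A [Adg Amax]] := @Zorn_bigcup _ (dominated_graph y0).
  move=> F FP Ftot; split.
  - by move=> x r [G FG Gx]; have [+ _ _] := FP _ FG; exact.
  - move=> c x r x' r' [G FG Gx] [G' FG' Gx'].
    have [GG|GG] := Ftot _ _ FG FG'.
      by exists G' => //; have [_ + _] := FP _ FG'; apply=> //; exact: GG.
    by exists G => //; have [_ + _] := FP _ FG; apply=> //; exact: GG.
  - by move=> e [G FG Ge]; exists G => //; have [_ _] := FP _ FG; apply; exact: Ge.
have Ay0 : A (y0, rnorm y0).
  apply: contrapT => nA.
  have A0 e : ~ A e by have [_ _ A3] := Adg => /A3.
  (* If the maximal graph missed [y0] it would be empty, and the real line through [y0] would be
     strictly larger. *)
  apply: (Amax [set e | exists t : R, e = (t%:C *: y0, t * rnorm y0)]).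
    split; first by move=> e /A0.
    move=> /(_ (y0, rnorm y0)) H; apply: nA; apply: H; exists 1.
    by rewrite rmorph1 scale1r mul1r.
  split.
  - move=> _ _ [t [-> ->]]; rewrite rnormZ rnorm_real.
    by rewrite ler_wpM2r ?rnorm_ge0 ?ler_norm.
  - move=> c _ _ _ _ [t [-> ->]] [t' [-> ->]]; exists (c * t + t').
    by rewrite scalerA rmorphD rmorphM scalerDl mulrDl mulrA.
  - by move=> _ _; exists 1; rewrite rmorph1 scale1r mul1r.
have Atot z : exists r, A (z, r).
  apply: contrapT => nz.
  have [G' G'dg [AG [r G'z]]] := dominated_graph_ext z Adg Ay0.
  apply: (Amax G') => //; split=> // GA; apply: nz; exists r; exact: GA.
have [Adom Alin _] := Adg.
(* By linearity [A] contains the pair of 0 and [r' - r], and domination at 0 applies. *)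
have Auniq_le x r r' : A (x, r) -> A (x, r') -> r' <= r.
  move=> Ar Ar'; have := Adom _ _ (Alin (-1) _ _ _ _ Ar Ar').
  by rewrite rmorphN1 scaleN1r addNr rnorm0; lra.
have Auniq x r r' : A (x, r) -> A (x, r') -> r = r'.
  by move=> Ar Ar'; apply/eqP; rewrite eq_le; apply/andP; split; apply: Auniq_le; eassumption.
pose u x := projT1 (cid (Atot x)).
have uA x : A (x, u x) by exact: projT2 (cid (Atot x)).
exists u; split.
- by move=> c x x'; apply: Auniq (uA _) _; exact: Alin.
- by move=> x; exact: Adom.
- exact: Auniq (uA _) Ay0.
Qed.

Definition is_functional (phi : Y -> R[i]^o) : Prop :=
  (forall (c : R[i]) (y1 y2 : Y), phi (c *: y1 + y2) = c * phi y1 + phi y2) /\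
  continuous phi.

Lemma norming_functional (y0 : Y) : exists phi : Y -> R[i]^o,
  [/\ is_functional phi, forall y, rnorm (phi y : C) <= rnorm y &
      phi y0 = (rnorm y0)%:C].
Proof.
have [u [ulin ule uy0]] := real_norming_functional y0.
have u0 : u 0 = 0.
  have := ulin 0 0 0; rewrite scaler0 addr0 mul0r add0r => _.
  by have := ulin 1 0 0; rewrite scaler0 addr0 mul1r; lra.
have uD x y : u (x + y) = u x + u y.
  by have := ulin 1 x y; rewrite rmorph1 scale1r mul1r.
have uZ (c : R) x : u (c%:C *: x) = c * u x.
  by have := ulin c x 0; rewrite u0 !addr0.
have uC (a b : R) x : u ((a +i* b) *: x) = a * u x + b * u ('i *: x).
  have -> : (a +i* b) = a%:C + b%:C * 'i :> C.
    by apply: eqReIm; rewrite !ReImE /=; ring.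
  by rewrite scalerDl uD uZ -scalerA uZ.
(* The complex-linear functional with real part [u]. *)
pose phi (y : Y) : C := u y +i* (- u ('i *: y)).
have philin (c : C) (y1 y2 : Y) : phi (c *: y1 + y2) = c * phi y1 + phi y2.
  case: c => a b; apply: eqReIm; rewrite /phi !ReImE /=.
    by rewrite uD uC; ring.
  rewrite scalerDr uD scalerA.
  have -> : 'i * (a +i* b) = (- b) +i* a :> C by apply: eqReIm; rewrite !ReImE /=; ring.
  by rewrite uC; ring.
have phi0 : phi 0 = 0 by rewrite /phi scaler0 u0 oppr0.
have phiZ c y : phi (c *: y) = c * phi y by have := philin c y 0; rewrite phi0 !addr0.
have phile y : rnorm (phi y) <= rnorm y.
  have [->|w0] := eqVneq (phi y) 0; first by rewrite rnorm0 rnorm_ge0.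
  have n0 := rnorm_gt0 w0.
  (* A unimodular factor turning [phi y] into its modulus, on which [phi] and [u] agree. *)
  pose c : C := (phi y)^-1 * (rnorm (phi y))%:C.
  have c1 : rnorm c = 1.
    by rewrite /c rnormM rnormV rnorm_real gtr0_norm// mulVf// gt_eqF.
  have := ule (c *: y); rewrite rnormZ c1 mul1r; apply: le_trans.
  have -> : u (c *: y) = Re (phi (c *: y)) by [].
  by rewrite phiZ /c mulrAC mulVf// mul1r.
exists phi; split=> //.
- split=> // x; apply/cvgrPdist_lt => e e0.
  have near_e : \forall t \near x, `|x - t| < e by exact: cvgr_dist_lt.
  apply: filterS near_e => t; apply: le_lt_trans.
  have -> : phi x - phi t = phi (x - t).
    have E := philin (-1) t x; rewrite scaleN1r mulN1r in E.
    by rewrite (addrC x) E addrC.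
  by rewrite !rnormE lecR.
- have ReE : Re (phi y0) = rnorm y0 by [].
  apply: eqReIm => //=; apply/eqP; rewrite -sqrf_eq0 eq_le sqr_ge0 andbT.
  have := phile y0; rewrite -(@ler_pXn2r _ 2%N) ?nnegrE ?rnorm_ge0// rnorm_sqr ReE /=.
  lra.
Qed.

(** Weak holomorphy, as in the hypothesis on [f]. Scalar identities carry over to [F] because the
    functionals separate points. *)
Definition vholo (F : C -> Y) (z : C) : Prop :=
  forall phi, is_functional phi -> holo (fun w => phi (F w)) z.

Lemma functional_sep (x y : Y) :
  (forall phi, is_functional phi -> phi x = phi y) -> x = y.
Proof.
move=> H; have [phi [phiF _ phixy]] := norming_functional (x - y).
apply/eqP; rewrite -subr_eq0; apply/eqP/rnorm0_eq0/complexI; rewrite -phixy.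
have [philin _] := phiF.
by have := philin (-1) y x; rewrite scaleN1r mulN1r addrC => ->; rewrite (H _ phiF) addNr.
Qed.

Lemma vholo_identity (F : C -> Y) (y0 : Y) (d : R) (p : C) : 0 < d ->
  (forall z, inQ z -> vholo F z) -> (forall z, rnorm z < d -> F z = y0) ->
  rnorm p <= 1 -> F p = y0.
Proof.
move=> d0 hF F0 p1; apply: functional_sep => phi phiF.
apply/eqP; rewrite -subr_eq0; apply/eqP.
apply: (@holo_identity _ (fun z => phi (F z) - phi y0) d) => // [z zQ|z /F0 ->].
  by apply: holoB; [exact: hF|exact: holo_cst].
by rewrite subrr.
Qed.

Lemma vholo_strong_maximum (F : C -> Y) (p : C) : strictly_convex Y ->
  (forall z, inQ z -> vholo F z) -> (forall z, inQ z -> rnorm (F z) <= rnorm (F 0)) ->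
  rnorm p <= 72^-1 -> F p = F 0.
Proof.
move=> scY hF Fmax p72.
have pQ : inQ p.
  have := Re_le_rnorm p; have := Im_le_rnorm p; rewrite !ler_norml.
  by move=> /andP[? ?] /andP[? ?]; split; lra.
have := rnorm_ge0 (F 0); rewrite le_eqVlt => /predU1P[F00|A0].
  have /rnorm0_eq0 -> : rnorm (F 0) = 0 by [].
  by apply: rnorm0_eq0; have := Fmax p pQ; have := rnorm_ge0 (F p); lra.
set A := rnorm (F 0) in A0 *.
have [phi [phiF phile phi0]] := norming_functional (F 0).
have phip : phi (F p) = A%:C.
  apply: (@strong_maximum _ (fun z => phi (F z)) A p) => //.
  - by move=> z zQ; exact: hF.
  - by move=> z zQ; apply: le_trans (phile _) _; exact: Fmax.
have FpA : rnorm (F p) = A.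
  apply/eqP; rewrite eq_le Fmax//=; have := phile (F p).
  by rewrite phip rnorm_real gtr0_norm.
apply: contrapT => Fne.
have AC : A%:C != 0 :> C by rewrite (fmorph_eq0 (real_complex R)) gt_eqF.
have nA : rnorm (A%:C^-1 : C) = A^-1 by rewrite rnormV rnorm_real gtr0_norm.
have := scY (A%:C^-1 *: F p) (A%:C^-1 *: F 0).
rewrite !rnormE !rnormZ nA FpA -/A mulVf ?gt_eqF// => /(_ erefl erefl) H.
have : rnorm ((2 : C)^-1 *: (A%:C^-1 *: F p + A%:C^-1 *: F 0)) < 1.
  rewrite -ltcR rnormZ; apply: H; apply/eqP => /(scalerI _) E; apply: Fne; apply: E.
  by rewrite invr_neq0.
(* The functional [phi] takes the value 1 at both normalised vectors, hence at their midpoint, whose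
   norm is therefore at least 1. *)
apply/negP; rewrite -leNgt; apply: le_trans (phile _).
have [philin _] := phiF.
have phiZ c y : phi (c *: y) = c * phi y.
  have p0 : phi 0 = 0.
    have E := philin 1 0 0; rewrite scaler0 addr0 mul1r in E.
    by apply: (@addrI _ (phi 0)); rewrite -E addr0.
  by have := philin c y 0; rewrite p0 !addr0.
rewrite phiZ philin phiZ phip phi0 -/A mulVf// -mulr2n -mulr_natl mulr1 mulVf ?pnatr_eq0//.
by rewrite -[1 : C]/(1%:C) rnorm_real normr1.
Qed.

End HahnBanach.

(** * Propagation of constancy *)

Section Propagation.
Variables (R : realType) (X : lmodType R[i]).
Local Notation C := R[i].

Definition independent2 (v w : X) : Prop :=
  forall a b : C, a *: v + b *: w = 0 -> a = 0 /\ b = 0.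

Lemma dopen_line (d : nat) (A : set X) (a w : X) : (0 < d)%N -> dopen d A -> A a ->
  exists2 e : R, 0 < e & forall m : C, rnorm m < e -> A (a + m *: w).
Proof.
move=> d0 Aop Aa; have [->|w0] := eqVneq w 0.
  by exists 1 => // m _; rewrite scaler0 addr0.
have ind : cindep (fun _ : 'I_1 => w).
  move=> t; rewrite big_ord1 => /eqP; rewrite scaler_eq0 (negbTE w0) orbF => /eqP t0 j.
  by rewrite ord1.
have [|e [e0 eP]] := Aop 1%N d0 a _ ind (fun=> 0).
  by rewrite big_ord1 scale0r addr0.
exists e => // m me; have := eP (fun=> m); rewrite big_ord1; apply => _.
by rewrite subr0 rnormE ltcR.
Qed.

Lemma dopen_plane (A : set X) (a v w : X) : dopen 2 A -> independent2 v w -> A a ->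
  exists2 e : R, 0 < e & forall m n : C, rnorm m < e -> rnorm n < e ->
    A (a + (m *: v + n *: w)).
Proof.
move=> Aop ind Aa; pose V (j : 'I_2) := if j == ord0 then v else w.
have sumV (t : 'I_2 -> C) : \sum_(j < 2) t j *: V j = t ord0 *: v + t (lift ord0 ord0) *: w.
  by rewrite big_ord_recl big_ord1.
have indV : cindep V.
  move=> t; rewrite sumV => /ind[t0 t1] j.
  case: (unliftP ord0 j) => [k|] ->; last exact: t0.
  by rewrite ord1.
have [|e [e0 eP]] := Aop 2%N isT a V indV (fun=> 0).
  by rewrite sumV !scale0r !addr0.
exists e => // m n me ne.
have := eP (fun j => if j == ord0 then m else n); rewrite sumV /=; apply => j.
by rewrite subr0 rnormE ltcR; case: ifP.
Qed.

Lemma independent2_complement (v w : X) : v != 0 -> ~ independent2 v w ->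
  exists al : C, w = al *: v.
Proof.
move=> v0 nind; apply: contrapT => nw; apply: nind => a b ab.
have [b0|b0] := eqVneq b 0.
  move: ab; rewrite b0 scale0r addr0 => /eqP; rewrite scaler_eq0 (negbTE v0) orbF.
  by move=> /eqP.
exfalso; apply: nw; exists (- (b^-1 * a)).
apply/eqP; rewrite scaleNr -addr_eq0 -scalerA -[X in X + _]scale1r -(mulVf b0).
by rewrite -scalerA -scalerDr addrC ab scaler0.
Qed.

(** Otherwise both vectors of an independent pair are multiples of [v], with coefficients [a] and
    [b]. Combining them with coefficients [b] and [- a] gives 0, so [a = 0] and the first vector
    vanishes. *)
Lemma dim_ge2_independent (v : X) : dim_ge2 X -> v != 0 -> exists w, independent2 v w.
Proof.
move=> [e eind] v0; apply: contrapT => nw.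
have ex j : exists al, e j = al *: v.
  by apply: independent2_complement => // H; apply: nw; exists (e j).
have [a aE] := ex ord0; have [b bE] := ex (lift ord0 ord0).
have H (s t : C) : s *: e ord0 + t *: e (lift ord0 ord0) = 0 -> s = 0 /\ t = 0.
  move=> st; have := eind (fun j => if j == ord0 then s else t).
  rewrite big_ord_recl big_ord1 /= => /(_ st) E; split; first exact: (E ord0).
  exact: (E (lift ord0 ord0)).
have [|b0 /eqP] := H b (- a).
  by rewrite aE bE !scalerA -scalerDl mulrC mulNr addrN scale0r.
rewrite oppr_eq0 => /eqP a0.
have [|/eqP] := H 1 0; first by rewrite aE a0 !scale0r scaler0 addr0.
by rewrite oner_eq0.
Qed.

Lemma inQ_rnorm (z : C) : inQ z -> rnorm z <= 4.
Proof.
move=> [z1 z2]; apply: le_trans (rnorm_le_ReIm _) _.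
apply: (@le_trans _ _ (2 + 2)); last by lra.
by apply: lerD; rewrite ler_norml; lra.
Qed.

(** * Constancy on lines, planes, segments and chains *)

Variables (Y : normedModType R[i]) (Omega : set X) (f : X -> Y).
Hypothesis Oopen : dopen 2 Omega.
Hypothesis fhol : GateauxHol Omega f.

(** The hypothesis is applied at the base point [a + m *: v] with parameter 0; the rest is a
    translation of the parameter by [m]. *)
Lemma gateaux_vholo (a v : X) (m : C) : Omega (a + m *: v) ->
  vholo (fun l => f (a + l *: v)) m.
Proof.
move=> Om phi [philin phic].
have := nbhs_singleton (fhol Om v philin phic).
rewrite /holo /derivable.
have -> // : (fun h : C => h^-1 *: (((fun l : C^o => phi (f (a + m *: v + l *: v))) \o shift 0)
   (h *: (1 : C^o)) - phi (f (a + m *: v + 0 *: v))) : C^o) =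
  (fun h : C => h^-1 *: (((fun w : C^o => phi (f (a + w *: v))) \o shift m) (h *: (1 : C^o))
   - phi (f (a + m *: v)))).
apply/funext => h /=; rewrite scale0r !addr0.
by rewrite scalerDl (addrC (_ *: v) (m *: v)) addrA.
Qed.

(* The radius may depend on the direction w. *)
Definition constant_near (y0 : Y) (x : X) : Prop :=
  forall w, exists2 e : R, 0 < e &
    forall m : C, rnorm m < e -> f (x + m *: w) = y0.

Lemma constant_near_max (U : set X) (c : X) : strictly_convex Y ->
  Omega c -> dopen 1 U -> U c -> 
  (forall x, U x -> Omega x -> rnorm (f x) <= rnorm (f c)) -> constant_near (f c) c.
Proof.
move=> scY Oc Uop Uc Umax w.
have [e1 e10 O1] := @dopen_line 2 _ _ w isT Oopen Oc.
have [e2 e20 U2] := @dopen_line 1 _ _ w isT Uop Uc.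
(* Points of the square have modulus at most 4, so after scaling by [r] it fits into both discs. *)
pose r := Num.min e1 e2 / 5.
have r0 : 0 < r by rewrite divr_gt0// lt_min e10.
have r1 : 5 * r <= e1 by rewrite mulrC divfK// ge_min lexx.
have r2 : 5 * r <= e2 by rewrite mulrC divfK// ge_min lexx orbT.
have rC : r%:C != 0 :> C by rewrite (fmorph_eq0 (real_complex R)) gt_eqF.
pose F (l : C) := f (c + l *: (r%:C *: w)).
have small (l : C) : inQ l -> rnorm (l * r%:C) < 5 * r.
  by move=> /inQ_rnorm l4; rewrite rnormM rnorm_real gtr0_norm// ltr_pM2r//; lra.
have FO l : inQ l -> Omega (c + l *: (r%:C *: w)).
  by move=> lQ; rewrite scalerA; apply: O1; apply: lt_le_trans r1; exact: small.
have FU l : inQ l -> U (c + l *: (r%:C *: w)).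
  by move=> lQ; rewrite scalerA; apply: U2; apply: lt_le_trans r2; exact: small.
have F0 : F 0 = f c by rewrite /F scale0r addr0.
exists (r / 72) => [|m mr]; first by rewrite divr_gt0.
have -> : m = (m / r%:C) * r%:C by rewrite divfK.
rewrite -F0 -scalerA -/(F _).
apply: vholo_strong_maximum => //.
- by move=> z /FO Oz; exact: gateaux_vholo.
- by move=> z zQ; rewrite F0; apply: Umax; [exact: FU|exact: FO].
- rewrite rnormM rnormV rnorm_real gtr0_norm// ler_pdivrMr//; lra.
Qed.

(** This makes the radius uniform: [d] depends on the direction, but the identity theorem on the
    line through [b] in that direction, evaluated at parameter 1, does not see [d]. The factor 5
    leaves room for the square, whose points have modulus at most 4. *)
Lemma spread (y0 : Y) (b v w : X) (e : R) : 0 < e ->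
  (forall m n : C, rnorm m < e -> rnorm n < e -> Omega (b + (m *: v + n *: w))) ->
  (forall m n : C, exists2 d : R, 0 < d &
     forall t : C, rnorm t < d -> f (b + t *: (m *: v + n *: w)) = y0) ->
  forall m n : C, rnorm m < e / 5 -> rnorm n < e / 5 ->
    f (b + (m *: v + n *: w)) = y0.
Proof.
move=> e0 Oe fe m n me ne; have [d d0 dP] := fe m n.
have := @vholo_identity _ _ (fun t => f (b + t *: (m *: v + n *: w))) y0 d 1 d0.
rewrite scale1r; apply => //; last by rewrite -[1 : C]/(1%:C) rnorm_real normr1.
move=> z /inQ_rnorm z4; apply: gateaux_vholo; rewrite scalerDr !scalerA.
have zle (q : C) : rnorm q < e / 5 -> rnorm (z * q) < e.
  rewrite rnormM => qe; have := rnorm_ge0 q; have := rnorm_ge0 z; nra.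
by apply: Oe; exact: zle.
Qed.

(** Constancy on a full neighbourhood in the plane, [T t], starts at [t = 0] by [spread] and is
    carried to [t = 1] in small steps, each justified by [spread] again. *)
Lemma constant_near_plane (y0 : Y) (z v w : X) : independent2 v w ->
  (forall t : R, 0 <= t <= 1 -> Omega (z + t%:C *: v)) -> constant_near y0 z ->
  exists2 e : R, 0 < e & forall m n : C, rnorm m < e -> rnorm n < e ->
    f (z + v + (m *: v + n *: w)) = y0.
Proof.
move=> ind Oseg gz.
pose T (t : R) := exists2 e : R, 0 < e & forall m n : C, rnorm m < e -> rnorm n < e ->
  f (z + t%:C *: v + (m *: v + n *: w)) = y0.
suff T01 : T 0 -> T (0 + 1).
  have [|e e0 eP] := T01.
    have Oz : Omega z by have := Oseg 0; rewrite scale0r addr0; apply; lra.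
    have [e e0 eP] := dopen_plane Oopen ind Oz.
    exists (e / 5); first by rewrite divr_gt0.
    rewrite scale0r addr0; apply: spread e0 eP _ => m n.
    exact: gz.
  by exists e => // m n me ne; rewrite -(eP m n)// add0r rmorph1 scale1r.
(* Rectangles of height 0 turn the quartering into a bisection of the interval from 0 to 1. *)
apply: (@rectangle_cousin _ (fun x _ a _ => T x -> T (x + a)) 0 0 1 0) => //.
  by move=> x y a b _ _ H1 H2 _ _ /H1 /H2; rewrite addrA.
move=> t t' t01 _; have Ot : Omega (z + t%:C *: v) by apply: Oseg; lra.
have [e e0 eP] := dopen_plane Oopen ind Ot.
(* Since [s] is within [e / 20] of [t], radius [e / 2] about [s] stays in [Omega]. Then [spread]
   gives constancy within [e / 10] of [s], which covers a step [a < e / 20] followed by a radius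
   [e / 20]. *)
exists (e / 20) => [|s s' a b]; first by rewrite divr_gt0.
move=> /andP[a0 ae] _ _ _ _ _ /andP[st ts] _ [d d0 dP] {s' b t'}.
have shift (s' : R) (q : R) (m n : C) : z + s'%:C *: v + (m *: v + n *: w) =
    z + q%:C *: v + (((s' - q)%:C + m) *: v + n *: w).
  by rewrite rmorphB /= scalerDl scalerBl addrA (addrA (z + _)) !addrA; congr (_ + _ + _);
    rewrite -!addrA; congr (_ + _); rewrite addrCA subrr addr0.
have near_s : forall m n : C, rnorm m < e / 2 / 5 -> rnorm n < e / 2 / 5 ->
    f (z + s%:C *: v + (m *: v + n *: w)) = y0.
  apply: spread => [|m n me ne|m n]; first by rewrite divr_gt0.
    rewrite (shift s t); apply: eP; last by lra.
    apply: le_lt_trans (rnormD _ _) _; rewrite rnorm_real ler0_norm; lra.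
  exists (d / (rnorm m + rnorm n + 1)).
    by rewrite divr_gt0//; have := rnorm_ge0 m; have := rnorm_ge0 n; lra.
  move=> q; rewrite ltr_pdivlMr; last by have := rnorm_ge0 m; have := rnorm_ge0 n; lra.
  move=> qd; rewrite scalerDr !scalerA; apply: dP; rewrite rnormM;
  by have := rnorm_ge0 m; have := rnorm_ge0 n; have := rnorm_ge0 q; nra.
exists (e / 20) => [|m n me ne]; first by rewrite divr_gt0.
rewrite (shift _ s); apply: near_s; last by lra.
apply: le_lt_trans (rnormD _ _) _; rewrite rnorm_real [s + a]addrC addrK ger0_norm//; lra.
Qed.

Lemma constant_near_segment (y0 : Y) (z z' : X) : dim_ge2 X ->
  segment z z' `<=` Omega -> constant_near y0 z -> constant_near y0 z'.
Proof.
move=> dim2 zz' gz w; have [<-//|vn0] := eqVneq z z'.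
have v0 : z' - z != 0 by rewrite subr_eq0 eq_sym.
pose v := z' - z.
have zv : z + v = z' by rewrite addrC subrK.
have Oseg (t : R) : 0 <= t <= 1 -> Omega (z + t%:C *: v).
  move=> t01; apply: zz'; exists t; split=> //.
  by rewrite scalerBl scale1r scalerBr addrAC addrA.
have [ind|nind] := pselect (independent2 v w).
  have [e e0 eP] := constant_near_plane ind Oseg gz.
  exists e => // m me; have := eP 0 m; rewrite zv scale0r add0r; apply=> //.
  by rewrite rnorm0.
(* A direction parallel to the segment is read off in any plane containing the segment; one exists
   since the dimension is at least 2. *)
have [al ->] := independent2_complement v0 nind.
have [u ind] := dim_ge2_independent dim2 v0.
have [e e0 eP] := constant_near_plane ind Oseg gz.
have al1 : 0 < rnorm al + 1 by have := rnorm_ge0 al; lra.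
exists (e / (rnorm al + 1)) => [|m]; first by rewrite divr_gt0.
rewrite ltr_pdivlMr// => me; have := eP (m * al) 0.
rewrite zv scale0r addr0 scalerA; apply; last by rewrite rnorm0.
by rewrite rnormM; have := rnorm_ge0 m; nra.
Qed.

Lemma constant_near_polychain (y0 : Y) (x y : X) (s : seq X) : dim_ge2 X ->
  polychain_in Omega x s y -> constant_near y0 x -> constant_near y0 y.
Proof.
move=> dim2; elim: s x => [|z s IH] x /=; first exact: constant_near_segment.
by move=> [xz zy] gx; apply: (IH z) => //; exact: constant_near_segment gx.
Qed.

End Propagation.

Theorem mainTheorem5 (R : realType) (X : lmodType R[i])
  (Y : completeNormedModType R[i]) (Omega : set X) (f : X -> Y) :
  dim_ge2 X ->
  strictly_convex Y ->
  dopen 2 Omega ->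
  polygonally_connected Omega ->
  GateauxHol Omega f ->
  has_tau1_local_max Omega (fun x => `|f x|) ->
  exists y0 : Y, forall x, Omega x -> f x = y0.
Proof.
move=> dim2 scY Oop Oconn fhol [c [Oc [U [Uop [Uc Umax]]]]].
exists (f c) => x Ox; have [s chain] := Oconn _ _ Oc Ox.
have gc : constant_near f (f c) c.
  apply: (constant_near_max Oop fhol scY Oc Uop Uc) => z Uz Oz.
  by rewrite -lecR -!rnormE; exact: Umax.
(* Constancy near [x] includes [x] itself, at parameter 0 in any direction. *)
have [e e0 /(_ 0)] := constant_near_polychain Oop fhol dim2 chain gc 0.
by rewrite scaler0 addr0 rnorm0; apply.
Qed.
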